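(* Let $k$ be an algebraically closed field, $A=kQ$ the path algebra of a finite quiver $Q$, $T$ a finite-dimensional left $A$-module, and $A[T]$ the one-point extension of $A$ by $T$. Assume $\mathrm{Ext}^1_A(T,T)=0$. Then for all full $A[T]$-modules $\tilde M,\tilde N$ one has \[ \mathrm{Ext}^2_{A[T]}(\tilde M,\tilde N)=0. \]
   Context: $A[T]$ is the $k$-algebra of formal matrices $\begin{pmatrix} a & t\\ 0&\lambda\end{pmatrix}$ with $a\in A$, $t\in T$, $\lambda\in k$, with componentwise addition and formal matrix multiplication. Left $A[T]$-modules are identified with triples $(M,V,f)$ where $M$ is a left $A$-module, $V$ a $k$-vector space and $f:T\otimes_kV\to M$ an $A$-module map; a morphism $(M,V,f)\to(N,W,g)$ is a pair $(\varphi_1:M\to N\text{ $A$-linear},\ \varphi_2:V\to W\text{ $k$-linear})$ with $\varphi_1f=g(\mathrm{id}_T\otimes\varphi_2)$. An $A[T]$-module $(M,V,f)$ is called full if $f$ is surjective. *)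

(* Defs.v *)
From HB Require Import structures.
From mathcomp Require Import all_boot all_algebra.
From mathcomp Require Import generic_quotient ring_quotient finmap.
From mathcomp Require Import boolp functions monalg.

Set Implicit Arguments.
Unset Strict Implicit.
Unset Printing Implicit Defensive.

Import GRing.Theory.

Local Open Scope ring_scope.
Local Open Scope quotient_scope.

(* A k-algebra is a ring with a central ring morphism from k.  MathComp's
   algType is not used because it demands 1 != 0, which fails for the path
   algebra of the quiver without vertices. *)
Record algebra (k : comPzRingType) := Algebra {
  alg_sort :> pzRingType;
  alg_scalar : {rmorphism k -> alg_sort};
  alg_central : forall c a, alg_scalar c * a = a * alg_scalar c
}.

Section ZmodMorphism.
Context (U V : zmodType) (f : U -> V) (fB : zmod_morphism f).

Lemma zmod_morph0 : f 0 = 0.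
Proof. by have := fB 0 0; rewrite !subrr. Qed.

Lemma zmod_morphD : {morph f : x y / x + y}.
Proof.
move=> x y; rewrite -{1}[y]opprK fB -[- y]sub0r fB zmod_morph0 sub0r.
by rewrite opprK.
Qed.

End ZmodMorphism.

Section Msum.
Context {K : choiceType} {G B : zmodType}.
Implicit Types (F : K -> G -> B) (x : {malg G[K]}).

Definition msum F x : B := \sum_(i <- msupp x) F i x@_i.

Lemma msumw F (d : {fset K}) x : (forall i, F i 0 = 0) ->
  (msupp x `<=` d)%fset -> msum F x = \sum_(i <- d) F i x@_i.
Proof.
move=> F0 le_d; rewrite /msum (big_fset_incl _ le_d) //= => i _.
by move/mcoeff_outdom ->.
Qed.

Lemma msum_is_zmod_morphism F :
  (forall i, zmod_morphism (F i)) -> zmod_morphism (msum F).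
Proof.
move=> FB x y; have F0 i : F i 0 = 0 by exact: zmod_morph0 (FB i).
have le_xy : (msupp x `<=` msupp x `|` msupp y)%fset by exact: fsubsetUl.
have le_yx : (msupp y `<=` msupp x `|` msupp y)%fset by exact: fsubsetUr.
rewrite (msumw F0 le_xy) (msumw F0 le_yx) (msumw F0 (msuppB_le x y)) -sumrB.
by apply: eq_bigr => i _; rewrite mcoeffB FB.
Qed.

Lemma msumU F i g : F i 0 = 0 -> msum F << g *g i >> = F i g.
Proof.
move=> F0; rewrite /msum msuppU; case: eqP => [->|_].
  by rewrite big_seq_fset0 F0.
by rewrite big_seq_fset1 mcoeffUU.
Qed.

Lemma malg_additive_eq (f g : {malg G[K]} -> B) :
  zmod_morphism f -> zmod_morphism g ->
  (forall c i, f << c *g i >> = g << c *g i >>) -> f =1 g.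
Proof.
move=> fB gB fg x.
have H (h : {malg G[K]} -> B) : zmod_morphism h ->
    h x = \sum_(i <- msupp x) h << x@_i *g i >>.
  move=> hB; pose hA := GRing.isZmodMorphism.Build _ _ h hB.
  pose h' : {additive {malg G[K]} -> B} := HB.pack h hA.
  by rewrite {1}[x]monalgE -[h]/(h' : _ -> _) raddf_sum.
by rewrite (H f) // (H g) //; apply: eq_bigr => i _.
Qed.

End Msum.

Definition free_module (R : pzRingType) (K : choiceType) : Type := {malg R[K]}.

Section FreeModule.
Context (R : pzRingType) (K : choiceType).

HB.instance Definition _ := GRing.Zmodule.on (free_module R K).

Definition free_scale (c : R) (x : free_module R K) : free_module R K :=
  [malg i in msupp x => c * x@_i].

Lemma free_scaleE c (x : free_module R K) i :
  mcoeff i (free_scale c x) = c * mcoeff i x.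
Proof. by rewrite mcoeffE; case: msuppP; rewrite ?mulr0. Qed.

Lemma free_scaleA a b x : free_scale a (free_scale b x) = free_scale (a * b) x.
Proof. by apply/malgP => i; rewrite !free_scaleE mulrA. Qed.

Lemma free_scale1r : left_id 1 free_scale.
Proof. by move=> x; apply/malgP => i; rewrite !free_scaleE mul1r. Qed.

Lemma free_scaleDr : right_distributive free_scale +%R.
Proof.
by move=> a x y; apply/malgP => i; rewrite !(free_scaleE, mcoeffD) mulrDr.
Qed.

Lemma free_scaleDl x : {morph free_scale^~ x : a b / a + b}.
Proof.
by move=> a b; apply/malgP => i; rewrite !(free_scaleE, mcoeffD) mulrDl.
Qed.

HB.instance Definition _ := GRing.Zmodule_isLmodule.Build R (free_module R K)
  free_scaleA free_scale1r free_scaleDr free_scaleDl.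

Lemma free_coeffZ c (x : free_module R K) i :
  mcoeff i (c *: x) = c * mcoeff i x.
Proof. exact: free_scaleE. Qed.

Lemma free_scaleU c d i :
  c *: (<< d *g i >> : free_module R K) = << c * d *g i >>.
Proof.
by apply/malgP => j; rewrite free_coeffZ !mcoeffU mulrnAr.
Qed.

End FreeModule.

Section Hom.
Context (R : pzRingType).

Definition is_linear (U V : lmodType R) (f : U -> V) : bool := `[< linear f >].

Section HomZmod.
Context (U V : lmodType R).

Fact is_linear_zmod_closed : zmod_closed (@is_linear U V : {pred U -> V}).
Proof.
split=> [|f g /asboolP fl /asboolP gl]; apply/asboolP => c x y.
  by rewrite scaler0 addr0.
by rewrite !fctE fl gl scalerBr opprD addrACA.
Qed.
HB.instance Definition _ :=
  GRing.isZmodClosed.Build (U -> V) (@is_linear U V) is_linear_zmod_closed.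

Record hom := Hom { hom_val :> U -> V; hom_valP : is_linear hom_val }.
HB.instance Definition _ := [isSub for hom_val].
HB.instance Definition _ := [Choice of hom by <:].
HB.instance Definition _ := [SubChoice_isSubZmodule of hom by <:].

Lemma hom_linear (f : hom) : linear f.
Proof. exact/asboolP/hom_valP. Qed.
HB.instance Definition _ (f : hom) :=
  GRing.isLinear.Build R U V *:%R (hom_val f) (hom_linear f).

Lemma homP (f g : hom) : f =1 g <-> f = g.
Proof. by split=> [fg|-> //]; apply/val_inj/funext. Qed.

Definition mk_hom (f : {linear U -> V}) : hom := Hom (asboolT (linearP f)).

End HomZmod.

Definition hom_comp (U V W : lmodType R) (g : hom V W) (f : hom U V) : hom U W :=
  mk_hom (hom_val g \o hom_val f).

Lemma hom_comp_is_zmod_morphism (U V W : lmodType R) (f : hom U V) :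
  zmod_morphism (fun g : hom V W => hom_comp g f).
Proof. by move=> g g'; apply/homP. Qed.

Section Kernel.
Context (U V : lmodType R) (f : hom U V).

Definition in_ker (u : U) : bool := f u == 0.

Fact in_ker_submod_closed : submod_closed (in_ker : {pred U}).
Proof.
split=> [|c u v /eqP fu /eqP fv]; apply/eqP; first by rewrite raddf0.
by rewrite hom_linear fu fv scaler0 addr0.
Qed.
HB.instance Definition _ := GRing.isSubmodClosed.Build R U in_ker
  in_ker_submod_closed.

Record kernel := Kernel { ker_val :> U; ker_valP : in_ker ker_val }.
HB.instance Definition _ := [isSub for ker_val].
HB.instance Definition _ := [Choice of kernel by <:].
HB.instance Definition _ := [SubChoice_isSubLmodule of kernel by <:].

End Kernel.
End Hom.

Section Ext.
Context (R : pzRingType).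

Section Cover.
Context (M : lmodType R).

Definition free_cover_fun (x : free_module R M) : M :=
  msum (fun (m : M) (c : R) => c *: m) x.

Fact free_cover_fun_is_linear : linear free_cover_fun.
Proof.
have addB : zmod_morphism free_cover_fun.
  by apply: msum_is_zmod_morphism => m a b; rewrite scalerBl.
have scaleB c : zmod_morphism (fun x : free_module R M => c *: x).
  by move=> x y; rewrite scalerBr.
have coverZ c x : free_cover_fun (c *: x) = c *: free_cover_fun x.
  move: x; apply: malg_additive_eq => [x y|x y|d m]; first by rewrite scalerBr addB.
    by rewrite addB scalerBr.
  by rewrite free_scaleU /free_cover_fun !msumU ?scale0r // scalerA.
by move=> c x y; rewrite -coverZ (zmod_morphD addB).
Qed.

Lemma free_cover_funU m : free_cover_fun << m >> = m.
Proof. by rewrite /free_cover_fun msumU ?scale0r // scale1r. Qed.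

HB.instance Definition _ :=
  GRing.isLinear.Build R (free_module R M) M *:%R free_cover_fun free_cover_fun_is_linear.

Definition free_cover : hom (free_module R M) M := mk_hom free_cover_fun.

End Cover.

(* The standard free resolution of M: F_n is the free module on the set
   Omega^n M, where Omega^0 M = M and Omega^(n+1) M is the kernel of the
   surjection F_n -> Omega^n M. *)
Fixpoint syzygy (n : nat) (M : lmodType R) : lmodType R :=
  if n is m.+1 then kernel (free_cover (syzygy m M)) else M.

Definition resolution (n : nat) (M : lmodType R) : lmodType R :=
  free_module R (syzygy n M).

Definition differential n M : hom (resolution n.+1 M) (resolution n M) :=
  hom_comp (mk_hom (\val : syzygy n.+1 M -> resolution n M)) (free_cover (syzygy n.+1 M)).

Section Cohomology.
Context (n : nat) (M N : lmodType R).

Definition cochain : zmodType := hom (resolution n M) N.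

Definition is_cocycle (c : cochain) : bool :=
  hom_comp c (differential n M) == 0.

Fact is_cocycle_zmod_closed : zmod_closed (is_cocycle : {pred cochain}).
Proof.
split=> [|c d /eqP cZ /eqP dZ]; apply/eqP; first exact/homP.
by rewrite hom_comp_is_zmod_morphism cZ dZ subrr.
Qed.
HB.instance Definition _ := GRing.isZmodClosed.Build cochain is_cocycle
  is_cocycle_zmod_closed.

Record cocycle := Cocycle { cocycle_val :> cochain; _ : is_cocycle cocycle_val }.
HB.instance Definition _ := [isSub for cocycle_val].
HB.instance Definition _ := [Choice of cocycle by <:].
HB.instance Definition _ := [SubChoice_isSubZmodule of cocycle by <:].

End Cohomology.

Definition coboundary (n : nat) (M N : lmodType R) : cochain n M N -> Prop :=
  match n return cochain n M N -> Prop with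
  | 0 => fun c => c = 0
  | m.+1 => fun c => exists b : cochain m M N, c = hom_comp b (differential m M)
  end.

Definition is_coboundary n (M N : lmodType R) (c : cocycle n M N) : bool :=
  `[< coboundary (cocycle_val c) >].

Fact is_coboundary_zmod_closed n (M N : lmodType R) :
  zmod_closed (@is_coboundary n M N : {pred cocycle n M N}).
Proof.
case: n => [|n]; split=> [|c d /asboolP cB /asboolP dB]; apply/asboolP => //=.
- by move: cB dB => /= cB dB; rewrite cB dB subrr.
- by exists 0; apply/homP.
- move: cB dB => /= [b cE] [b' dE]; exists (b - b').
  by rewrite hom_comp_is_zmod_morphism -cE -dE.
Qed.
HB.instance Definition _ n (M N : lmodType R) := GRing.isZmodClosed.Build
  (cocycle n M N) (@is_coboundary n M N) (@is_coboundary_zmod_closed n M N).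

Definition coboundaries n (M N : lmodType R) : zmodClosed (cocycle n M N) :=
  GRing.ZmodClosed.clone (cocycle n M N) (@is_coboundary n M N) _.

Definition Ext n (M N : lmodType R) : zmodType :=
  {ideal_quot (coboundaries n M N)}.

Lemma Ext_eq0 n (M N : lmodType R) : (forall x : Ext n M N, x = 0) <->
  (forall c : cocycle n M N, coboundary (cocycle_val c)).
Proof.
pose E := {ideal_quot (coboundaries n M N)}.
have piE0 (c : cocycle n M N) : (\pi_E c == 0) = is_coboundary c.
  have := Quotient.idealrBE (coboundaries n M N) c 0.
  by rewrite subr0 -[is_coboundary c]/(c \in coboundaries n M N) => ->; rewrite !piE.
split=> [ext0 c|cob x]; first by have := piE0 c; rewrite (ext0 (\pi_E c)) eqxx => /esym/asboolP.
rewrite -[x](@reprK _ E); apply/eqP; rewrite [_ == _]piE0; exact/asboolP/cob.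
Qed.

End Ext.

Section Quiver.

Record quiver := Quiver {
  vertex : finType;
  arrow : finType;
  source : arrow -> vertex;
  target : arrow -> vertex
}.

Context (Q : quiver).

Fixpoint is_walk (i : vertex Q) (s : seq (arrow Q)) : bool :=
  if s is a :: s' then (source a == i) && is_walk (target a) s' else true.

(* A path is its starting vertex together with its arrows, in the order in
   which they are traversed; the empty sequence gives the trivial paths. *)
Record qpath := QPath {
  path_val : vertex Q * seq (arrow Q);
  path_valP : is_walk path_val.1 path_val.2
}.
HB.instance Definition _ := [isSub for path_val].
HB.instance Definition _ := [Choice of qpath by <:].

Definition path_source (p : qpath) : vertex Q := (path_val p).1.
Definition path_arrows (p : qpath) : seq (arrow Q) := (path_val p).2.
Definition path_target (p : qpath) : vertex Q :=
  last (path_source p) (map (@target Q) (path_arrows p)).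

Definition trivial_path (i : vertex Q) : qpath := @QPath (i, [::]) isT.

Lemma is_walk_cat i s t : is_walk i (s ++ t) =
  is_walk i s && is_walk (last i (map (@target Q) s)) t.
Proof. by elim: s i => //= a s IHs i; rewrite IHs andbA. Qed.

(* path_comp p q traverses q first and then p, and is undefined unless q ends
   where p starts; with this convention left modules over the path algebra are
   covariant representations of the quiver. *)
Definition path_comp (p q : qpath) : option qpath :=
  if path_target q == path_source p
  then insub (path_source q, path_arrows q ++ path_arrows p) else None.

Lemma path_ext p q : path_source p = path_source q ->
  path_arrows p = path_arrows q -> p = q.
Proof.
move=> sE aE; apply: val_inj => /=; move: sE aE.
by rewrite /path_source /path_arrows; case: (path_val p) (path_val q) => [? ?] [? ?] /= -> ->.
Qed.

Variant path_comp_spec (p q : qpath) : option qpath -> Type :=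
| PathCompSome r of path_target q = path_source p
    & path_source r = path_source q & path_target r = path_target p
    & path_arrows r = path_arrows q ++ path_arrows p
  : path_comp_spec p q (Some r)
| PathCompNone of path_target q <> path_source p : path_comp_spec p q None.

Lemma path_compP p q : path_comp_spec p q (path_comp p q).
Proof.
rewrite /path_comp; case: eqP => [qp|]; last by constructor.
have walk : is_walk (path_source q) (path_arrows q ++ path_arrows p).
  rewrite is_walk_cat (path_valP q) /= -/(path_target q) qp; exact: path_valP.
rewrite insubT; constructor=> //.
by rewrite {1}/path_target /path_source /path_arrows /= map_cat last_cat
  -/(path_target q) qp.
Qed.

Lemma path_compA p q r :
  obind (path_comp p) (path_comp q r) = obind (path_comp^~ r) (path_comp p q).
Proof.
case: (path_compP q r) => [s rq ss st sa|rq] /=;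
  case: (path_compP p q) => [u qp us ut ua|qp] //=.
- case: path_compP => [v _ vs _ va|]; last by rewrite st.
  case: path_compP => [w _ ws _ wa|]; last by rewrite us.
  congr Some; apply: path_ext; first by rewrite vs ws ss.
  by rewrite va wa sa ua catA.
- by case: path_compP => // v; rewrite st => /qp.
- by case: path_compP => // v; rewrite us => /rq.
Qed.

Lemma trivial_path_comp i p :
  path_comp (trivial_path i) p = if path_target p == i then Some p else None.
Proof.
case: path_compP => [r pi rs _ ra|pi]; last by move/eqP/negbTE: pi => /= ->.
rewrite pi /path_source /= eqxx; congr Some; apply: path_ext => //.
by rewrite ra cats0.
Qed.

Lemma path_comp_trivial i p :
  path_comp p (trivial_path i) = if path_source p == i then Some p else None.
Proof.
rewrite eq_sym; case: path_compP => [r pi rs _ ra|pi].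
  rewrite -[i]/(path_target (trivial_path i)) pi eqxx; congr Some.
  by apply: path_ext; rewrite ?ra // rs -pi.
by move/eqP/negbTE: pi => /= ->.
Qed.

End Quiver.

Section PathAlgebra.
Context (k : fieldType) (Q : quiver).

Definition path_ring : Type := free_module k (qpath Q).
HB.instance Definition _ := GRing.Lmodule.on path_ring.
Implicit Types x y z : path_ring.

Definition path_monomial (c : k) (o : option (qpath Q)) : path_ring :=
  if o is Some p then << c *g p >> else 0.

Definition path_mul x y : path_ring :=
  msum (fun p c => msum (fun q d => path_monomial (c * d) (path_comp p q)) y) x.

Definition path_one : path_ring := \sum_(i : vertex Q) << trivial_path i >>.

Lemma path_monomialB o : zmod_morphism (path_monomial^~ o).
Proof.
case: o => [p|] c d; first exact: (monalgUB (p : qpath Q) c d).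
by rewrite /= subr0.
Qed.

Let mono0 o : path_monomial 0 o = 0.
Proof. by case: o => //= p; rewrite monalgU0. Qed.

Lemma path_mulBr x : zmod_morphism (path_mul x).
Proof.
move=> y z; rewrite /path_mul /msum -sumrB; apply: eq_bigr => p _.
apply: (@msum_is_zmod_morphism _ _ path_ring (fun q d =>
  path_monomial (x@_p * d) (path_comp p q))) => q c d.
by rewrite mulrBr path_monomialB.
Qed.

Lemma path_mulBl y : zmod_morphism (path_mul^~ y).
Proof.
apply: (@msum_is_zmod_morphism _ _ _ (fun (p : qpath Q) c =>
  msum (fun q d => path_monomial (c * d) (path_comp p q)) y)) => p c d.
rewrite /msum -sumrB.
by apply: eq_bigr => q _; rewrite mulrBl path_monomialB.
Qed.

Lemma path_mulUU c d p q : path_mul << c *g p >> << d *g q >> =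
  path_monomial (c * d) (path_comp p q).
Proof.
rewrite /path_mul msumU; first by rewrite msumU // mulr0 mono0.
by rewrite /msum big1 // => i _; rewrite mul0r mono0.
Qed.

Let mul0 x : path_mul x 0 = 0. Proof. exact: zmod_morph0 (path_mulBr x). Qed.
Let mul0l y : path_mul 0 y = 0. Proof. exact: zmod_morph0 (path_mulBl y). Qed.

Let mulDr : right_distributive path_mul +%R.
Proof. by move=> x; exact: zmod_morphD (path_mulBr x). Qed.

Let mulDl : left_distributive path_mul +%R.
Proof. by move=> x y z; exact: (zmod_morphD (path_mulBl z)). Qed.

Lemma path_additive_eq (f g : path_ring -> path_ring) :
  zmod_morphism f -> zmod_morphism g ->
  (forall c p, f (path_monomial c (Some p)) = g (path_monomial c (Some p))) ->
  f =1 g.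
Proof. exact: malg_additive_eq. Qed.

Lemma path_mulSS c d p q :
  path_mul (path_monomial c (Some p)) (path_monomial d (Some q)) =
  path_monomial (c * d) (path_comp p q).
Proof. exact: path_mulUU. Qed.

Lemma path_mulA : associative path_mul.
Proof.
move=> x y z; move: x; apply: path_additive_eq => [x x'|x x'|c p].
- exact: path_mulBl.
- exact: etrans (congr1 (path_mul^~ z) (path_mulBl y x x')) (path_mulBl z _ _).
set P := path_monomial c _; move: y.
apply: path_additive_eq => [y y'|y y'|d q].
- exact: etrans (congr1 (path_mul P) (path_mulBl z y y')) (path_mulBr P _ _).
- exact: etrans (congr1 (path_mul^~ z) (path_mulBr P y y')) (path_mulBl z _ _).
set D := path_monomial d _; move: z.
apply: path_additive_eq => [z z'|z z'|e r].
- exact: etrans (congr1 (path_mul P) (path_mulBr D z z')) (path_mulBr P _ _).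
- exact: path_mulBr.
transitivity (path_mul P (path_monomial (d * e) (path_comp q r))).
  exact: (congr1 (path_mul P) (path_mulSS d e q r)).
transitivity (path_mul (path_monomial (c * d) (path_comp p q))
                       (path_monomial e (Some r))); last first.
  exact: (congr1 (path_mul^~ _) (esym (path_mulSS c d p q))).
have := path_compA p q r.
case: (path_comp q r) => [s|]; case: (path_comp p q) => [t|] /= E.
- apply: etrans (path_mulSS c _ p s) (etrans _ (esym (path_mulSS _ e t r))).
  by rewrite mulrA E.
- by apply: etrans (path_mulSS c _ p s) _; rewrite E; exact: esym (mul0l _).
- by apply: etrans (mul0 _) (etrans _ (esym (path_mulSS _ e t r))); rewrite -E.
- exact: etrans (mul0 _) (esym (mul0l _)).
Qed.

Lemma path_mul1x : left_id path_one path_mul.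
Proof.
apply: path_additive_eq => [x y|//|c p]; first exact: path_mulBr.
rewrite /path_one (big_morph (path_mul^~ _) (fun _ _ => mulDl _ _ _) (mul0l _)).
rewrite (bigD1 (path_target p)) //= big1 => [|i /negbTE ip].
  by rewrite path_mulUU trivial_path_comp eqxx mul1r addr0.
by rewrite path_mulUU trivial_path_comp eq_sym ip.
Qed.

Lemma path_mulx1 : right_id path_one path_mul.
Proof.
apply: path_additive_eq => [x y|//|c p]; first exact: path_mulBl.
rewrite /path_one (big_morph (path_mul _) (fun _ _ => mulDr _ _ _) (mul0 _)).
rewrite (bigD1 (path_source p)) //= big1 => [|i /negbTE ip].
  by rewrite path_mulUU path_comp_trivial eqxx mulr1 addr0.
by rewrite path_mulUU path_comp_trivial eq_sym ip.
Qed.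

HB.instance Definition _ := GRing.Zmodule_isPzRing.Build path_ring
  path_mulA path_mul1x path_mulx1 mulDl mulDr.

Lemma path_scaleS c d o :
  c *: path_monomial d o = path_monomial (c * d) o.
Proof. by case: o => [p|]; [exact: free_scaleU | exact: scaler0]. Qed.

Lemma path_mulRSS c d p q :
  path_monomial c (Some p) * path_monomial d (Some q) =
  path_monomial (c * d) (path_comp p q).
Proof. exact: path_mulUU. Qed.

Lemma path_scaleAl (c : k) x y : c *: (x * y) = (c *: x) * y.
Proof.
move: x; apply: path_additive_eq => [x x'|x x'|d p].
- by rewrite mulrBl scalerBr.
- by rewrite scalerBr mulrBl.
move: y; apply: path_additive_eq => [y y'|y y'|e q].
- by rewrite mulrBr scalerBr.
- by rewrite mulrBr.
transitivity (c *: path_monomial (d * e) (path_comp p q)).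
  exact: (congr1 ( *:%R c) (path_mulRSS d e p q)).
transitivity (path_monomial (c * d) (Some p) * path_monomial e (Some q)).
  by apply: etrans (path_scaleS _ _ _) _; rewrite mulrA; exact: esym (path_mulRSS _ _ _ _).
exact: (congr1 ( *%R^~ _) (esym (path_scaleS c d (Some p)))).
Qed.

Lemma path_scaleAr (c : k) x y : c *: (x * y) = x * (c *: y).
Proof.
move: x; apply: path_additive_eq => [x x'|x x'|d p].
- by rewrite mulrBl scalerBr.
- by rewrite mulrBl.
move: y; apply: path_additive_eq => [y y'|y y'|e q].
- by rewrite mulrBr scalerBr.
- by rewrite scalerBr mulrBr.
transitivity (c *: path_monomial (d * e) (path_comp p q)).
  exact: (congr1 ( *:%R c) (path_mulRSS d e p q)).
transitivity (path_monomial d (Some p) * path_monomial (c * e) (Some q)).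
  by apply: etrans (path_scaleS _ _ _) _; rewrite mulrCA; exact: esym (path_mulRSS _ _ _ _).
exact: (congr1 ( *%R _) (esym (path_scaleS c e (Some q)))).
Qed.

Definition path_scalar (c : k) : path_ring := c *: (1 : path_ring).

Fact path_scalar_is_zmod_morphism : zmod_morphism path_scalar.
Proof. by move=> c d; rewrite /path_scalar scalerBl. Qed.
Fact path_scalar_is_monoid_morphism : monoid_morphism path_scalar.
Proof.
split=> [|c d]; first exact: scale1r.
by rewrite /path_scalar -path_scaleAl mul1r scalerA.
Qed.
HB.instance Definition _ := GRing.isZmodMorphism.Build k path_ring path_scalar
  path_scalar_is_zmod_morphism.
HB.instance Definition _ := GRing.isMonoidMorphism.Build k path_ring path_scalar
  path_scalar_is_monoid_morphism.

Fact path_scalar_central c x : path_scalar c * x = x * path_scalar c.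
Proof. by rewrite -path_scaleAl -path_scaleAr mul1r mulr1. Qed.

Definition path_algebra : algebra k := Algebra path_scalar_central.

End PathAlgebra.

Section Tensor.
Context (k : fieldType) (A : algebra k).

Definition scalar_act (M : lmodType A) (c : k) (m : M) : M :=
  alg_scalar A c *: m.

Section TensorDef.
Context (T : lmodType A) (V : lmodType k).

Definition tensor_free : zmodType := {malg int[(T * V)%type]}.

Definition pure (t : T) (v : V) : tensor_free := << (t, v) >>.

Inductive tensor_rel : tensor_free -> Prop :=
| TensorRelDl t t' v : tensor_rel (pure (t + t') v - (pure t v + pure t' v))
| TensorRelDr t v v' : tensor_rel (pure t (v + v') - (pure t v + pure t v'))
| TensorRelZ c t v : tensor_rel (pure (scalar_act c t) v - pure t (c *: v)).

(* The subgroup generated by the relations of the tensor product over k. *)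
Definition in_tensor_rels (x : tensor_free) : bool :=
  `[< forall S : tensor_free -> Prop,
        S 0 -> (forall y z, S y -> S z -> S (y - z)) ->
        (forall r, tensor_rel r -> S r) -> S x >].

Fact in_tensor_rels_zmod_closed :
  zmod_closed (in_tensor_rels : {pred tensor_free}).
Proof.
split=> [|x y /asboolP xS /asboolP yS]; apply/asboolP => S S0 SB SR //.
by apply: (SB x y); [apply: (xS S) | apply: (yS S)].
Qed.
HB.instance Definition _ := GRing.isZmodClosed.Build tensor_free in_tensor_rels
  in_tensor_rels_zmod_closed.

Definition tensor : Type :=
  {ideal_quot (GRing.ZmodClosed.clone tensor_free in_tensor_rels _)}.
HB.instance Definition _ := GRing.Zmodule.on tensor.
HB.instance Definition _ := EqQuotient.on tensor.

Definition tensor_pi (x : tensor_free) : tensor := \pi_tensor x.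

Definition tmk (t : T) (v : V) : tensor := tensor_pi (pure t v).

Lemma tensor_piP x y : reflect (tensor_pi x = tensor_pi y) (in_tensor_rels (x - y)).
Proof.
by rewrite -[in_tensor_rels _]/(x - y \in GRing.ZmodClosed.clone tensor_free in_tensor_rels _)
  Quotient.idealrBE; apply: eqP.
Qed.

Lemma tensor_piB : zmod_morphism tensor_pi.
Proof. by move=> x y; rewrite /tensor_pi !piE. Qed.

Definition tensor_ext (B : zmodType) (b : T -> V -> B) (x : tensor_free) : B :=
  msum (fun (p : T * V) (n : int) => b p.1 p.2 *~ n) x.

Lemma tensor_extB (B : zmodType) (b : T -> V -> B) : zmod_morphism (tensor_ext b).
Proof. by apply: msum_is_zmod_morphism => p m n; rewrite mulrzBr. Qed.

Lemma tensor_ext_pure (B : zmodType) (b : T -> V -> B) t v :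
  tensor_ext b (pure t v) = b t v.
Proof. by rewrite /tensor_ext msumU. Qed.

Definition balanced (B : zmodType) (b : T -> V -> B) : Prop :=
  [/\ forall t t' v, b (t + t') v = b t v + b t' v,
      forall t v v', b t (v + v') = b t v + b t v' &
      forall c t v, b (scalar_act c t) v = b t (c *: v)].

Definition tensor_lift (B : zmodType) (b : T -> V -> B) (u : tensor) : B :=
  tensor_ext b (repr u).

Lemma tensor_lift_pi (B : zmodType) (b : T -> V -> B) : balanced b ->
  forall x, tensor_lift b (tensor_pi x) = tensor_ext b x.
Proof.
move=> [bDl bDr bZ] x; apply/eqP; rewrite -subr_eq0 -tensor_extB; apply/eqP.
have /tensor_piP/asboolP : tensor_pi (repr (tensor_pi x)) = tensor_pi x.
  by rewrite /tensor_pi reprK.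
have extB := @tensor_extB B b; move/(_ (fun y => tensor_ext b y = 0)); apply.
- exact: zmod_morph0 extB.
- by move=> y z y0 z0; rewrite extB y0 z0 subrr.
- move=> _ [t t' v|t v v'|c t v]; rewrite extB ?(zmod_morphD extB);
    by rewrite !tensor_ext_pure ?bDl ?bDr ?bZ subrr.
Qed.

Lemma tensor_eq (B : zmodType) (f g : tensor -> B) :
  zmod_morphism f -> zmod_morphism g ->
  (forall t v, f (tmk t v) = g (tmk t v)) -> f =1 g.
Proof.
move=> fB gB fg u; rewrite -[u]reprK -/(tensor_pi _).
move: (repr u); apply: malg_additive_eq => [x y|x y|c [t v]].
- by rewrite tensor_piB fB.
- by rewrite tensor_piB gB.
have H (h : tensor -> B) : zmod_morphism h ->
    h (tensor_pi << c *g (t, v) >>) = h (tmk t v) *~ c.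
  move=> hB; pose h0 := fun n : int => h (tensor_pi << n *g (t, v) >>).
  have h0B : zmod_morphism h0.
    by move=> m n; rewrite /h0 monalgUB tensor_piB hB.
  pose h1 : {additive int -> B} := HB.pack h0 (GRing.isZmodMorphism.Build _ _ h0 h0B).
  by rewrite -[LHS]/(h1 c) -[c in LHS]intz raddfMz.
by rewrite (H f) // (H g) // fg.
Qed.

Lemma tensor_pi_rel x y : tensor_rel (x - y) -> tensor_pi x = tensor_pi y.
Proof. by move=> xy; apply/tensor_piP/asboolP => S _ _; move/(_ _ xy). Qed.

Lemma tmk_balanced : balanced tmk.
Proof.
have pD := zmod_morphD tensor_piB.
split=> [t t' v|t v v'|c t v].
- exact: etrans (tensor_pi_rel (TensorRelDl t t' v)) (pD _ _).
- exact: etrans (tensor_pi_rel (TensorRelDr t v v')) (pD _ _).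
- exact: tensor_pi_rel (TensorRelZ c t v).
Qed.

Lemma tensor_liftB (B : zmodType) (b : T -> V -> B) :
  balanced b -> zmod_morphism (tensor_lift b).
Proof.
move=> bb u v; rewrite -[u]reprK -[v]reprK -!/(tensor_pi _) -tensor_piB.
by rewrite !tensor_lift_pi // tensor_extB.
Qed.

Lemma tensor_lift_tmk (B : zmodType) (b : T -> V -> B) : balanced b ->
  forall t v, tensor_lift b (tmk t v) = b t v.
Proof. by move=> bb t v; rewrite tensor_lift_pi // tensor_ext_pure. Qed.

Definition tensor_scale (a : A) : tensor -> tensor :=
  tensor_lift (fun t v => tmk (a *: t) v).

Lemma scale_balanced (a : A) : balanced (fun t v => tmk (a *: t) v).
Proof.
have [Dl Dr Z] := tmk_balanced.
split=> [t t' v|t v v'|c t v]; first by rewrite scalerDr Dl.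
  by rewrite Dr.
by rewrite -Z /scalar_act !scalerA alg_central.
Qed.

Lemma tensor_scaleB a : zmod_morphism (tensor_scale a).
Proof. exact: tensor_liftB (scale_balanced a). Qed.

Lemma tensor_scale_tmk a t v : tensor_scale a (tmk t v) = tmk (a *: t) v.
Proof. exact: tensor_lift_tmk (scale_balanced a) t v. Qed.

Fact tensor_scaleA a b u : tensor_scale a (tensor_scale b u) = tensor_scale (a * b) u.
Proof.
move: u; apply: tensor_eq => [u v|u v|t v].
- by rewrite !tensor_scaleB.
- by rewrite tensor_scaleB.
by rewrite !tensor_scale_tmk scalerA.
Qed.

Fact tensor_scale1 : left_id 1 tensor_scale.
Proof.
apply: tensor_eq => [u v|//|t v]; first by rewrite tensor_scaleB.
by rewrite tensor_scale_tmk scale1r.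
Qed.

Fact tensor_scaleDr : right_distributive tensor_scale +%R.
Proof. by move=> a; exact: zmod_morphD (tensor_scaleB a). Qed.

Fact tensor_scaleDl u : {morph tensor_scale^~ u : a b / a + b}.
Proof.
move=> a b; move: u; apply: tensor_eq => [u v|u v|t v].
- by rewrite tensor_scaleB.
- by rewrite !tensor_scaleB opprD addrACA.
have [Dl _ _] := tmk_balanced.
by rewrite !tensor_scale_tmk scalerDl Dl.
Qed.

HB.instance Definition _ := GRing.Zmodule_isLmodule.Build A tensor
  tensor_scaleA tensor_scale1 tensor_scaleDr tensor_scaleDl.

End TensorDef.
End Tensor.

Section OnePointExtension.
Context (k : fieldType) (A : algebra k) (T : lmodType A).

(* (a, t, l) stands for the formal matrix with rows (a t) and (0 l). *)
Definition opext : Type := (A * T * k)%type.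
HB.instance Definition _ := GRing.Zmodule.on opext.

Definition opmx (a : A) (t : T) (l : k) : opext := (a, t, l).

Definition opext_mul (x y : opext) : opext :=
  let: (a, t, l) := x in let: (b, u, m) := y in
  opmx (a * b) (a *: u + scalar_act m t) (l * m).

Definition opext_one : opext := opmx 1 0 1.

Let sact_central a c (t : T) : a *: scalar_act c t = scalar_act c (a *: t).
Proof. by rewrite /scalar_act !scalerA alg_central. Qed.

Let opmxD a t l b u m : opmx a t l + opmx b u m = opmx (a + b) (t + u) (l + m).
Proof. by []. Qed.

Fact opext_mulA : associative opext_mul.
Proof.
move=> [[a t] l] [[b u] m] [[c v] n]; congr opmx; rewrite ?mulrA //.
rewrite scalerDr scalerA sact_central -addrA; congr (_ + _).
by rewrite [RHS]scalerDr; congr (_ + _); rewrite /scalar_act scalerA -rmorphM mulrC.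
Qed.

Fact opext_mul1x : left_id opext_one opext_mul.
Proof.
move=> [[a t] l]; rewrite /= !mul1r scale1r /scalar_act scaler0 addr0.
by [].
Qed.

Fact opext_mulx1 : right_id opext_one opext_mul.
Proof.
move=> [[a t] l]; rewrite /= !mulr1 scaler0 add0r /scalar_act rmorph1 scale1r.
by [].
Qed.

Fact opext_mulDl : left_distributive opext_mul +%R.
Proof.
move=> [[a t] l] [[b u] m] [[c v] n]; congr opmx; rewrite ?mulrDl //.
by rewrite scalerDl /scalar_act scalerDr addrACA.
Qed.

Fact opext_mulDr : right_distributive opext_mul +%R.
Proof.
move=> [[a t] l] [[b u] m] [[c v] n]; congr opmx; rewrite ?mulrDr //.
by rewrite scalerDr /scalar_act rmorphD scalerDl addrACA.
Qed.

HB.instance Definition _ := GRing.Zmodule_isPzRing.Build opext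
  opext_mulA opext_mul1x opext_mulx1 opext_mulDl opext_mulDr.

Lemma opmxM a t l b u m :
  opmx a t l * opmx b u m = opmx (a * b) (a *: u + scalar_act m t) (l * m).
Proof. by []. Qed.

Definition opext_scalar (c : k) : opext := opmx (alg_scalar A c) 0 c.

Fact opext_scalar_is_zmod_morphism : zmod_morphism opext_scalar.
Proof. by move=> c d; congr opmx; rewrite ?rmorphB ?subr0. Qed.
Fact opext_scalar_is_monoid_morphism : monoid_morphism opext_scalar.
Proof.
split=> [|c d]; first by congr opmx; rewrite rmorph1.
by rewrite opmxM /scalar_act !scaler0 addr0 -rmorphM.
Qed.
HB.instance Definition _ := GRing.isZmodMorphism.Build k opext opext_scalar
  opext_scalar_is_zmod_morphism.
HB.instance Definition _ := GRing.isMonoidMorphism.Build k opext opext_scalar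
  opext_scalar_is_monoid_morphism.

Fact opext_scalar_central c x : opext_scalar c * x = x * opext_scalar c.
Proof.
move: x => [[a t] l]; rewrite -[(a, t, l)]/(opmx a t l) !opmxM.
by rewrite alg_central /scalar_act !scaler0 addr0 add0r mulrC.
Qed.

Definition one_point_extension : algebra k := Algebra opext_scalar_central.

End OnePointExtension.

(* The triple (M, V, f) of an A[T]-module X: with e = diag(1, 0) and
   e' = diag(0, 1), M = e X, V = e' X and f (t (x) v) is the product of v by
   the matrix with single nonzero entry t. *)
Section Triple.
Context (k : fieldType) (A : algebra k) (T : lmodType A).
Context (X : lmodType (one_point_extension T)).

Definition opact (a : A) (t : T) (l : k) (x : X) : X :=
  (opmx a t l : one_point_extension T) *: x.

Lemma opactB a t l : zmod_morphism (opact a t l).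
Proof. by move=> x y; rewrite /opact scalerBr. Qed.

Lemma opact_comp a t l b u m x : opact a t l (opact b u m x) =
  opact (a * b) (a *: u + scalar_act m t) (l * m) x.
Proof. by rewrite /opact scalerA. Qed.

Lemma opactDl a t l b u m x :
  opact (a + b) (t + u) (l + m) x = opact a t l x + opact b u m x.
Proof. by rewrite /opact -scalerDl. Qed.

Definition in_algebra_part (x : X) : bool := opact 1 0 0 x == x.
Definition in_vector_part (x : X) : bool := opact 0 0 1 x == x.

Fact in_algebra_part_zmod_closed : zmod_closed (in_algebra_part : {pred X}).
Proof.
split=> [|x y /eqP xM /eqP yM]; apply/eqP; first exact: scaler0.
by rewrite opactB xM yM.
Qed.
HB.instance Definition _ := GRing.isZmodClosed.Build X in_algebra_part
  in_algebra_part_zmod_closed.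

Fact in_vector_part_zmod_closed : zmod_closed (in_vector_part : {pred X}).
Proof.
split=> [|x y /eqP xM /eqP yM]; apply/eqP; first exact: scaler0.
by rewrite opactB xM yM.
Qed.
HB.instance Definition _ := GRing.isZmodClosed.Build X in_vector_part
  in_vector_part_zmod_closed.

Record algebra_part := AlgebraPart {
  algebra_part_val :> X; algebra_partP : in_algebra_part algebra_part_val }.
HB.instance Definition _ := [isSub for algebra_part_val].
HB.instance Definition _ := [Choice of algebra_part by <:].
HB.instance Definition _ := [SubChoice_isSubZmodule of algebra_part by <:].

Record vector_part := VectorPart {
  vector_part_val :> X; vector_partP : in_vector_part vector_part_val }.
HB.instance Definition _ := [isSub for vector_part_val].
HB.instance Definition _ := [Choice of vector_part by <:].
HB.instance Definition _ := [SubChoice_isSubZmodule of vector_part by <:].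

Fact algebra_scale_subproof a (x : algebra_part) : in_algebra_part (opact a 0 0 x).
Proof.
apply/eqP; rewrite opact_comp !mul1r scaler0 /scalar_act scaler0 addr0.
by rewrite mul0r.
Qed.

Definition algebra_scale a (x : algebra_part) : algebra_part :=
  AlgebraPart (algebra_scale_subproof a x).

Fact algebra_scaleA a b x :
  algebra_scale a (algebra_scale b x) = algebra_scale (a * b) x.
Proof.
apply: val_inj; rewrite /= opact_comp scaler0 /scalar_act scaler0 addr0.
by rewrite mul0r.
Qed.

Fact algebra_scale1 : left_id 1 algebra_scale.
Proof. by move=> x; apply: val_inj; exact/eqP/algebra_partP. Qed.

Fact algebra_scaleDr : right_distributive algebra_scale +%R.
Proof. by move=> a x y; apply: val_inj; exact: scalerDr. Qed.

Fact algebra_scaleDl x : {morph algebra_scale^~ x : a b / a + b}.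
Proof.
by move=> a b; apply: val_inj; rewrite [RHS]/= -opactDl /= !addr0.
Qed.

HB.instance Definition _ := GRing.Zmodule_isLmodule.Build A algebra_part
  algebra_scaleA algebra_scale1 algebra_scaleDr algebra_scaleDl.

Fact vector_scale_subproof l (x : vector_part) : in_vector_part (opact 0 0 l x).
Proof.
apply/eqP; rewrite opact_comp !mul1r scaler0 /scalar_act scaler0 addr0.
by rewrite mul0r.
Qed.

Definition vector_scale l (x : vector_part) : vector_part :=
  VectorPart (vector_scale_subproof l x).

Fact vector_scaleA a b x :
  vector_scale a (vector_scale b x) = vector_scale (a * b) x.
Proof.
apply: val_inj; rewrite /= opact_comp scaler0 /scalar_act scaler0 addr0.
by rewrite mul0r.
Qed.

Fact vector_scale1 : left_id 1 vector_scale.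
Proof. by move=> x; apply: val_inj; exact/eqP/vector_partP. Qed.

Fact vector_scaleDr : right_distributive vector_scale +%R.
Proof. by move=> a x y; apply: val_inj; exact: scalerDr. Qed.

Fact vector_scaleDl x : {morph vector_scale^~ x : a b / a + b}.
Proof.
by move=> a b; apply: val_inj; rewrite [RHS]/= -opactDl /= !addr0.
Qed.

HB.instance Definition _ := GRing.Zmodule_isLmodule.Build k vector_part
  vector_scaleA vector_scale1 vector_scaleDr vector_scaleDl.

Fact corner_subproof t (v : vector_part) : in_algebra_part (opact 0 t 0 v).
Proof.
apply/eqP; rewrite opact_comp mulr0 scale1r /scalar_act scaler0 addr0.
by rewrite mulr0.
Qed.

Definition corner (t : T) (v : vector_part) : algebra_part :=
  AlgebraPart (corner_subproof t v).

Fact corner_balanced : balanced corner.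
Proof.
split=> [t t' v|t v v'|c t v]; apply: val_inj.
- by rewrite [RHS]/= -opactDl !addr0.
- exact: scalerDr.
- by rewrite /= opact_comp scale0r add0r mulr0 mul0r.
Qed.

Definition structure_map : tensor T vector_part -> algebra_part :=
  tensor_lift corner.

Lemma structure_map_tmk t v : structure_map (tmk t v) = corner t v.
Proof. exact: tensor_lift_tmk corner_balanced t v. Qed.

Fact structure_map_is_linear : linear structure_map.
Proof.
have fB : zmod_morphism structure_map := tensor_liftB corner_balanced.
have fZ a u : structure_map (a *: u) = a *: structure_map u.
  move: u; apply: tensor_eq => [u v|u v|t v]; rewrite ?scalerBr ?fB ?scalerBr //.
  rewrite [a *: _]tensor_scale_tmk !structure_map_tmk; apply: val_inj.
  by rewrite /= opact_comp mulr0 /scalar_act scaler0 addr0 mulr0.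
by move=> a u v; rewrite (zmod_morphD fB) fZ.
Qed.
HB.instance Definition _ := GRing.isLinear.Build A (tensor T vector_part)
  algebra_part *:%R structure_map structure_map_is_linear.

Definition full : Prop := forall m : algebra_part, exists u, structure_map u = m.

End Triple.

Definition finite_dimensional (k : fieldType) (A : algebra k)
    (M : lmodType A) : Prop :=
  exists s : seq M, forall m : M, exists c : nat -> k,
    m = \sum_(i < size s) scalar_act (c i) s`_i.

(* Main.v *)
Require Import Defs.
From mathcomp Require Import all_boot all_algebra.
From mathcomp Require Import finmap.
From mathcomp Require Import boolp classical_sets monalg.
From HB Require Import structures.
Import Defs.

Set Implicit Arguments.
Unset Strict Implicit.
Unset Printing Implicit Defensive.

Import GRing.Theory.

Local Open Scope ring_scope.

(** Write A for the path algebra, B for A[T], and split every B-module X into its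
  algebra part, an A-module, and its vector part, a vector space.  Over a field,
  Ext^1(M, N) vanishes exactly when every derivation d of the algebra with values in
  the k-linear maps from M to N is inner, that is, d a m = a psi m - psi (a m) for
  some k-linear psi, a potential of d.  In this form the argument needs, besides
  k-linear complements, only two facts about path algebras: a derivation is
  determined by its values on the vertices and the arrows
  (path_derivation_eq0), and values on the arrows may be chosen freely
  (path_derivationP).

  By dimension shift, Ext^2_B(M, N) = 0 follows if the derivations on the first
  syzygy O of M, a submodule of a free B-module F, are inner for N
  (derivations_inner_Ext_eq0).  This is reached from Ext^1_A(T, T) = 0 in four steps.

  - The hypothesis says that derivations from T to T are inner
    (Ext1_eq0_derivations_inner).

  - N is full, so its algebra part N1 is a quotient of a sum of copies of T.  Values
    on arrows can be lifted along a surjection, and T is finite-dimensional, so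
    derivations from T to N1 are inner (derivations_inner_full).  This is the right
    exactness of Ext^1_A(T, -), together with its compatibility with sums.

  - The algebra part of F is a sum of copies of A and T, so derivations from it to N1
    are inner (derivations_inner_free).  Since A is hereditary, the same holds for the
    algebra part of the submodule O (derivations_inner_sub).

  - It remains to pass from A to B.  Inside a free B-module, multiplication by T
    embeds the tensor product of T with the vector part U of O as a submodule of the
    algebra part of O, and A-linear maps on this submodule extend to the algebra part
    of O, since U is a direct summand of the vector part of F.  This turns a potential
    over A into one over B (derivations_inner_glue). *)

(** * Linear algebra over the ground field *)

Section Additive.
Context (U V : zmodType) (f : U -> V) (fB : zmod_morphism f).

Lemma zmod_morph_sum (I : Type) (r : seq I) (F : I -> U) :
  f (\sum_(i <- r) F i) = \sum_(i <- r) f (F i).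
Proof. exact: (big_morph f (zmod_morphD fB) (zmod_morph0 fB)). Qed.

Lemma zmod_morph_mulz x (n : int) : f (x *~ n) = f x *~ n.
Proof.
pose h : {additive U -> V} := HB.pack f (GRing.isZmodMorphism.Build _ _ f fB).
exact: (raddfMz h).
Qed.

End Additive.

Section ScalarAct.
Context (k : fieldType) (A : algebra k) (M : lmodType A).
Implicit Types (c : k) (m : M) (a : A).

Lemma scalar_actDr c : {morph @scalar_act k A M c : x y / x + y}.
Proof. by move=> x y; rewrite /scalar_act scalerDr. Qed.

Lemma scalar_actBr c : zmod_morphism (@scalar_act k A M c).
Proof. by move=> x y; rewrite /scalar_act scalerBr. Qed.

Lemma scalar_actDl c d m :
  scalar_act (c + d) m = scalar_act c m + scalar_act d m.
Proof. by rewrite /scalar_act rmorphD scalerDl. Qed.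

Lemma scalar_act0 c : scalar_act c (0 : M) = 0.
Proof. exact: scaler0. Qed.

Lemma scalar_act0l m : scalar_act 0 m = 0.
Proof. by rewrite /scalar_act rmorph0 scale0r. Qed.

Lemma scalar_act1 m : scalar_act 1 m = m.
Proof. by rewrite /scalar_act rmorph1 scale1r. Qed.

Lemma scalar_actA c d m : scalar_act c (scalar_act d m) = scalar_act (c * d) m.
Proof. by rewrite /scalar_act scalerA rmorphM. Qed.

Lemma scalar_actN c m : scalar_act c (- m) = - scalar_act c m.
Proof. by rewrite /scalar_act scalerN. Qed.

Lemma scale_scalar_act a c m : a *: scalar_act c m = scalar_act c (a *: m).
Proof. by rewrite /scalar_act !scalerA alg_central. Qed.

Lemma scalar_act_scale a c m : (alg_scalar A c * a) *: m = scalar_act c (a *: m).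
Proof. by rewrite /scalar_act scalerA. Qed.

End ScalarAct.

(** Domain and codomain may be modules over two different algebras: a map
  between them can then only be asked to be linear over the ground field. *)
Definition klinear (k : fieldType) (A B : algebra k) (M : lmodType A)
    (N : lmodType B) (f : M -> N) : Prop :=
  forall c x y, f (scalar_act c x + y) = scalar_act c (f x) + f y.

Section Klinear.
Context (k : fieldType).

Section Basic.
Context (A B : algebra k) (M : lmodType A) (N : lmodType B) (f : M -> N).
Hypothesis fl : klinear f.

Lemma klinearB : zmod_morphism f.
Proof.
move=> x y; have fD u v : f (u + v) = f u + f v.
  by have := fl 1 u v; rewrite !scalar_act1.
have := fD (x - y) y; rewrite subrK => ->; by rewrite addrK.
Qed.

Lemma klinear0 : f 0 = 0. Proof. exact: zmod_morph0 klinearB. Qed.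

Lemma klinearD : {morph f : x y / x + y}. Proof. exact: zmod_morphD klinearB. Qed.

Lemma klinearZ c x : f (scalar_act c x) = scalar_act c (f x).
Proof. by have := fl c x 0; rewrite klinear0 !addr0. Qed.

End Basic.

Lemma klinear_comp (A B C : algebra k) (M : lmodType A) (N : lmodType B)
    (P : lmodType C) (g : N -> P) (f : M -> N) :
  klinear g -> klinear f -> klinear (g \o f).
Proof. by move=> gl fl c x y; rewrite /= fl gl. Qed.

Lemma klinear_scale (A : algebra k) (M : lmodType A) (a : A) :
  klinear (fun m : M => a *: m).
Proof. by move=> c x y; rewrite scalerDr scale_scalar_act. Qed.

Lemma klinear_add (A B : algebra k) (M : lmodType A) (N : lmodType B)
  (f g : M -> N) : klinear f -> klinear g -> klinear (fun x => f x + g x).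
Proof. by move=> fl gl c x y; rewrite fl gl scalar_actDr addrACA. Qed.

Lemma klinear_opp (A B : algebra k) (M : lmodType A) (N : lmodType B)
  (f : M -> N) : klinear f -> klinear (fun x => - f x).
Proof. by move=> fl c x y; rewrite fl opprD scalar_actN. Qed.

Lemma klinear_sub (A B : algebra k) (M : lmodType A) (N : lmodType B)
  (f g : M -> N) : klinear f -> klinear g -> klinear (fun x => f x - g x).
Proof. by move=> fl gl; exact: klinear_add fl (klinear_opp gl). Qed.

Lemma klinear_sum (A B : algebra k) (M : lmodType A) (N : lmodType B)
    (I : Type) (r : seq I) (f : I -> M -> N) :
  (forall i, klinear (f i)) -> klinear (fun x => \sum_(i <- r) f i x).
Proof.
move=> fl c x y; rewrite (zmod_morph_sum (scalar_actBr c)) -big_split /=.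
by apply: eq_bigr => i _; rewrite fl.
Qed.

Lemma linear_klinear (A : algebra k) (M N : lmodType A) (f : M -> N) :
  linear f -> klinear f.
Proof. by move=> fl c x y; exact: fl. Qed.

End Klinear.
Arguments klinear_scale {k A M} a c x y.

Section Complement.
Context (k : fieldType) (A : algebra k) (M : lmodType A).

Definition ksubspace (S : M -> Prop) : Prop :=
  forall c x y, S x -> S y -> S (scalar_act c x + y).

Lemma ksubspaceB (S : M -> Prop) x y : ksubspace S -> S x -> S y -> S (x - y).
Proof.
move=> Sl Sx Sy; rewrite addrC; have := Sl (-1) y x Sy Sx.
by rewrite /scalar_act rmorphN rmorph1 scaleN1r.
Qed.

Let avoids (S C : M -> Prop) := ksubspace C /\ forall x, C x -> S x -> x = 0.

(** A maximal subspace among those meeting S trivially: a vector m outside S + C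
  could be added to C. *)
Lemma ksubspace_complement (S : M -> Prop) : ksubspace S -> S 0 ->
  exists C, [/\ ksubspace C, C 0, forall x, C x -> S x -> x = 0 &
    forall m, exists s c, [/\ S s, C c & m = s + c]].
Proof.
move=> Sl S0.
have [|C [[Cl CS] Cmax]] := @Zorn_bigcup M [set C | avoids S C]%classic.
  move=> F Favoid Ftot; split=> [c x y [X FX Xx] [Y FY Yy]|x [X FX Xx]].
    have [XY|YX] := Ftot _ _ FX FY.
      by exists Y => //; apply: (Favoid _ FY).1 => //; exact: XY.
    by exists X => //; apply: (Favoid _ FX).1 => //; exact: YX.
  exact: (Favoid _ FX).2.
(* The empty set is among the candidates, since it is the union of the empty
   chain; so that C contains 0 has to be drawn from its maximality. *)
have C0 : C 0.
  apply: contrapT => nC0; apply: (Cmax (fun x => C x \/ x = 0)).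
    by split=> [x Cx|/(_ 0 (or_intror erefl))//]; left.
  split=> [c x y [Cx|->] [Cy|->]|x [Cx|->] Sx //]; last exact: CS.
  - by left; exact: Cl.
  - have /(ksubspaceB Cl) := Cl c x x Cx Cx; move=> /(_ x Cx).
    by rewrite addrK addr0; left.
  - by rewrite scalar_act0 add0r; left.
  - by rewrite scalar_act0 add0r; right.
exists C; split=> // m; apply: contrapT => nm.
pose C' := (fun x => exists l c, C c /\ x = scalar_act l m + c).
apply: (Cmax C'); first split.
- move=> x Cx; exists 0, x; split=> //; by rewrite scalar_act0l add0r.
- move=> /(_ m) CC; apply: nm; exists 0, m; split=> //; last by rewrite add0r.
  by apply: CC; exists 1, 0; rewrite scalar_act1 addr0.
split=> [d x y [l [c [Cc ->]]] [l' [c' [Cc' ->]]]|x [l [c [Cc xE]]] Sx].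
  exists (d * l + l'), (scalar_act d c + c'); split; first exact: Cl.
  by rewrite scalar_actDr scalar_actA scalar_actDl addrACA.
have [l0|l0] := eqVneq l 0.
  by move: xE; rewrite l0 scalar_act0l add0r => xE; apply: CS; rewrite // xE.
case: nm; exists (scalar_act l^-1 x), (- scalar_act l^-1 c); split.
- by have := Sl l^-1 x 0 Sx S0; rewrite addr0.
- rewrite -sub0r; apply: ksubspaceB => //.
  by have := Cl l^-1 c 0 Cc C0; rewrite addr0.
- by rewrite xE scalar_actDr scalar_actA mulVf // scalar_act1 addrK.
Qed.

End Complement.

Section Splitting.
Context (k : fieldType) (A B : algebra k) (M : lmodType A) (N : lmodType B).

Lemma klinear_retraction (i : M -> N) : klinear i -> injective i ->
  exists r : N -> M, klinear r /\ cancel i r.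
Proof.
move=> il iI; have [||C [Cl C0 CS SC]] := @ksubspace_complement _ _ N
    (fun y => exists x, y = i x).
- by move=> c _ _ [x ->] [y ->]; exists (scalar_act c x + y); rewrite il.
- by exists 0; rewrite klinear0.
have /choice[r rP] n : exists x, C (n - i x).
  have [s [c [[x ->] Cc ->]]] := SC n; by exists x; rewrite addrAC subrr add0r.
have r_uniq n x : C (n - i x) -> r n = x.
  move=> Cx; apply: iI; apply/eqP; rewrite -subr_eq0; apply/eqP.
  apply: CS; last by exists (r n - x); rewrite klinearB.
  have := ksubspaceB Cl Cx (rP n); by rewrite opprB addrC addrA subrK.
exists r; split=> [c x y|x]; apply: r_uniq; last by rewrite subrr.
rewrite il opprD addrACA -scalar_actBr; exact: Cl.
Qed.

Lemma klinear_section (p : M -> N) : klinear p -> (forall y, exists x, p x = y) ->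
  exists s : N -> M, klinear s /\ cancel s p.
Proof.
move=> pl ps; have [||C [Cl C0 CS SC]] := @ksubspace_complement _ _ M
    (fun x => p x = 0).
- by move=> c x y x0 y0; rewrite pl x0 y0 scalar_act0 addr0.
- exact: klinear0.
have /choice[s sP] n : exists x, C x /\ p x = n.
  have [x <-] := ps n; have [y [c [y0 Cc ->]]] := SC x.
  by exists c; rewrite klinearD // y0 add0r.
have s_uniq x : C x -> s (p x) = x.
  move=> Cx; apply/eqP; rewrite -subr_eq0; apply/eqP; apply: CS.
    by apply: ksubspaceB => //; exact: (sP _).1.
  by rewrite klinearB // (sP _).2 subrr.
exists s; split=> [c x y|y]; last exact: (sP y).2.
have [[Cx {1}<-] [Cy {1}<-]] := (sP x, sP y).
by rewrite -pl s_uniq //; exact: Cl.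
Qed.

End Splitting.

(** * Extensions of homomorphisms and derivations *)

Section HomMorphism.
Context (R : pzRingType) (U V : lmodType R) (f : hom U V).

Lemma homB : zmod_morphism f. Proof. exact: raddfB. Qed.
Lemma hom0 : f 0 = 0. Proof. exact: raddf0. Qed.
Lemma homD : {morph f : x y / x + y}. Proof. exact: raddfD. Qed.
Lemma homZ a x : f (a *: x) = a *: f x. Proof. exact: linearZ. Qed.

End HomMorphism.

Lemma hom_factor (R : pzRingType) (P U N : lmodType R) (p : hom P U)
    (c : hom P N) : (forall u, exists x, p x = u) ->
  (forall x, p x = 0 -> c x = 0) -> exists h : hom U N, forall x, c x = h (p x).
Proof.
move=> /choice[s sK] c0.
have cE x y : p x = p y -> c x = c y.
  move=> pxy; apply/eqP; rewrite -subr_eq0 -homB; apply/eqP/c0.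
  by rewrite homB pxy subrr.
have hl : linear (fun u => c (s u)).
  by move=> a u v; rewrite -hom_linear; apply: cE; rewrite hom_linear !sK.
by exists (Hom (asboolT hl)) => x; apply: cE; rewrite sK.
Qed.

Section FreeLift.
Context (R : pzRingType) (K : choiceType) (N : lmodType R) (phi : K -> N).

Definition free_lift (f : free_module R K) : N := msum (fun x b => b *: phi x) f.

Lemma free_liftU b x : free_lift << b *g x >> = b *: phi x.
Proof. by rewrite /free_lift msumU // scale0r. Qed.

Lemma free_liftB : zmod_morphism free_lift.
Proof. by apply: msum_is_zmod_morphism => x b c; rewrite scalerBl. Qed.

Fact free_lift_is_linear : linear free_lift.
Proof.
have liftZ c f : free_lift (c *: f) = c *: free_lift f.
  move: f; apply: malg_additive_eq => [x y|x y|d x].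
  - by rewrite scalerBr free_liftB.
  - by rewrite free_liftB scalerBr.
  - by rewrite free_scaleU !free_liftU scalerA.
by move=> c x y; rewrite (zmod_morphD free_liftB) liftZ.
Qed.
HB.instance Definition _ := GRing.isLinear.Build R (free_module R K) N *:%R
  free_lift free_lift_is_linear.

End FreeLift.

Lemma free_coverU1 (R : pzRingType) (U : lmodType R) (u : U) :
  free_cover U << u >> = u.
Proof. exact: free_cover_funU. Qed.

Lemma free_coverU (R : pzRingType) (U : lmodType R) b (u : U) :
  free_cover U << b *g u >> = b *: u.
Proof. exact: (free_liftU id). Qed.

(** A cocycle of degree n + 1 is a map out of the syzygy of degree n + 1, and
  it is a coboundary when this map extends to the free module around it. *)
Lemma Ext_eq0_extend (R : pzRingType) n (M N : lmodType R) :
  (forall x : Ext n.+1 M N, x = 0) <->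
  (forall h : hom (kernel (free_cover (syzygy n M))) N,
    exists g : hom (free_module R (syzygy n M)) N, forall z, g (\val z) = h z).
Proof.
set U := syzygy n M; split=> [/Ext_eq0 ext0 h|ext].
  pose c : cochain n.+1 M N := hom_comp h (free_cover (syzygy n.+1 M)).
  have cZ : is_cocycle c.
    apply/eqP/homP => x; rewrite /c /=.
    have /eqP := ker_valP (free_cover (kernel (free_cover (syzygy n.+1 M))) x).
    by move=> E; rewrite /= -[RHS](hom0 h) -E.
  have [g gP] := ext0 (Cocycle cZ); exists g => z.
  have /homP/(_ << z >>) := gP; rewrite /= /c /=.
  by rewrite !free_cover_funU => ->.
apply/Ext_eq0 => -[c cocycle_c]; have /eqP cZ := cocycle_c; rewrite /coboundary /=.
have c0 x : free_cover (syzygy n.+1 M) x = 0 -> c x = 0.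
  move=> /eqP x0; have /homP/(_ << Kernel x0 >>) := cZ.
  by rewrite /= free_cover_funU.
have [|h hP] := hom_factor _ c0.
  by move=> z; exists << z >>; exact: free_cover_funU.
by have [g gP] := ext h; exists g; apply/homP => x; rewrite hP /= -gP.
Qed.

Section Derivation.
Context (k : fieldType) (A : algebra k).

(** The derivations of A with values in the bimodule of k-linear maps from M
  to N, in uncurried form. *)
Record derivation (M N : lmodType A) (d : A -> M -> N) : Prop := Derivation {
  der_klinear : forall a, klinear (d a);
  der_additive : forall m, zmod_morphism (d^~ m);
  der_scalar : forall c m, d (alg_scalar A c) m = 0;
  der_mul : forall a b m, d (a * b) m = a *: d b m + d a (b *: m)
}.

Definition inner_derivation (M N : lmodType A) (psi : M -> N) (a : A) (m : M) : N :=
  a *: psi m - psi (a *: m).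

(** The vanishing of the first Hochschild cohomology group of A with
  coefficients in the k-linear maps from M to N.  Over a field this group is
  Ext^1(M, N), and a cocycle with k-linear values can be restricted, extended and
  lifted one component at a time. *)
Definition derivations_inner (M N : lmodType A) : Prop :=
  forall d : A -> M -> N, derivation d ->
    exists psi, klinear psi /\ forall a m, d a m = inner_derivation psi a m.

Section Properties.
Context (M N : lmodType A).
Implicit Types (d : A -> M -> N).

Lemma inner_derivationP (psi : M -> N) :
  klinear psi -> derivation (inner_derivation psi).
Proof.
rewrite /inner_derivation => psil; have psiB := klinearB psil.
split=> [a|m a b|c m|a b m].
- apply: klinear_sub; last exact: klinear_comp psil (klinear_scale _).
  exact: klinear_comp (klinear_scale _) psil.
- by rewrite !scalerBl psiB !opprD addrACA.
- by rewrite -/(scalar_act c _) -/(scalar_act c m) (klinearZ psil) subrr.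
- by rewrite scalerBr !scalerA addrA subrK.
Qed.

Lemma derivationB d a b m : derivation d -> d (a - b) m = d a m - d b m.
Proof. by move=> dd; exact: der_additive dd m a b. Qed.

Lemma derivation0 d m : derivation d -> d 0 m = 0.
Proof. by move=> dd; exact: zmod_morph0 (der_additive dd m). Qed.

Lemma derivationD d a b m : derivation d -> d (a + b) m = d a m + d b m.
Proof. by move=> dd; exact: zmod_morphD (der_additive dd m) a b. Qed.

Lemma derivation_sub d d' : derivation d -> derivation d' ->
  derivation (fun a m => d a m - d' a m).
Proof.
move=> dd dd'; split=> [a|m|c m|a b m].
- exact: klinear_sub (der_klinear dd a) (der_klinear dd' a).
- by move=> a b; rewrite !derivationB // !opprD addrACA.
- by rewrite !der_scalar // subrr.
- by rewrite !der_mul // opprD addrACA scalerBr.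
Qed.

Lemma derivation1 d m : derivation d -> d 1 m = 0.
Proof. by move=> dd; rewrite -(rmorph1 (alg_scalar A)) der_scalar. Qed.

Lemma derivationZ d c a m : derivation d ->
  d (alg_scalar A c * a) m = scalar_act c (d a m).
Proof. by move=> dd; rewrite (der_mul dd) (der_scalar dd) addr0. Qed.

Lemma derivation_comp (K : lmodType A) (i : hom K M) d : derivation d ->
  derivation (fun a x => d a (i x)).
Proof.
move=> dd; split=> [a|x|c x|a b x]; last by rewrite (der_mul dd) homZ.
- exact: klinear_comp (der_klinear dd a) (linear_klinear (hom_linear i)).
- exact: der_additive dd (i x).
- exact: der_scalar dd c (i x).
Qed.

(** Subtracting the inner derivation of - sum_i d(eps_i) eps_i makes a
  derivation vanish on a complete system of orthogonal idempotents. *)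
Lemma derivations_inner_normalised (I : finType) (eps : I -> A) :
  (forall i j, eps i * eps j = if i == j then eps i else 0) ->
  \sum_i eps i = 1 ->
  (forall d, derivation d -> (forall i m, d (eps i) m = 0) ->
    exists psi, klinear psi /\ forall a m, d a m = inner_derivation psi a m) ->
  derivations_inner M N.
Proof.
move=> epsM eps1 H d dd.
pose psi0 m := - \sum_i d (eps i) (eps i *: m).
have psi0l : klinear psi0.
  apply/klinear_opp/klinear_sum => i.
  exact: klinear_comp (der_klinear dd _) (klinear_scale _).
have [] := H _ (derivation_sub dd (inner_derivationP psi0l)).
  move=> j m; apply/eqP; rewrite subr_eq0; apply/eqP.
  rewrite /inner_derivation /psi0 scalerN scaler_sumr opprK.
  have sumj : \sum_i d (eps i) (eps i *: (eps j *: m)) = d (eps j) (eps j *: m).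
    rewrite (bigD1 j) //= big1 => [|i /negbTE ij].
      by rewrite addr0 scalerA epsM eqxx.
    by rewrite scalerA epsM ij scale0r (klinear0 (der_klinear dd _)).
  have sumj' i : eps j *: d (eps i) (eps i *: m) =
      d (eps j * eps i) (eps i *: m) - d (eps j) (eps i *: m).
    by rewrite der_mul // scalerA epsM eqxx addrK.
  rewrite (eq_bigr _ (fun i _ => sumj' i)) sumrB sumj.
  rewrite (bigD1 j) //= big1 => [|i ij]; last first.
    by rewrite epsM eq_sym (negbTE ij) derivation0.
  rewrite epsM eqxx addr0 opprB -[RHS]addrA addNr addr0.
  rewrite -(zmod_morph_sum (klinearB (der_klinear dd _))) -scaler_suml eps1.
  by rewrite scale1r.
move=> psi [psil psiP]; exists (fun m => psi m + psi0 m).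
split=> [|a m]; first exact: klinear_add.
have /eqP := psiP a m; rewrite subr_eq => /eqP ->.
by rewrite /inner_derivation scalerDr opprD addrACA.
Qed.

(** A derivation d gives a map on the kernel of the free cover of M, sending
  the combination of the [m] with coefficients a_m to the sum of the d a_m m;
  the values at the [m] of an extension of this map exhibit d as inner. *)
Lemma Ext1_eq0_derivations_inner :
  (forall x : Ext 1%N M N, x = 0) -> derivations_inner M N.
Proof.
move=> /Ext_eq0_extend ext d dd.
pose D (f : free_module A M) : N := msum (fun m a => d a m) f.
have dB m : zmod_morphism (d^~ m) := der_additive dd m.
have DU a m : D << a *g m >> = d a m.
  by rewrite /D msumU // (zmod_morph0 (dB m)).
have DB : zmod_morphism D by exact: msum_is_zmod_morphism.
have DZ a f : D (a *: f) = a *: D f + d a (free_cover M f).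
  move: f; apply: malg_additive_eq => [x y|x y|b m].
  - by rewrite scalerBr DB.
  - by rewrite DB scalerBr homB (klinearB (der_klinear dd a)) opprD addrACA.
  - by rewrite free_scaleU !DU der_mul // free_coverU.
have Dl : linear (fun z : kernel (free_cover M) => D (\val z)).
  move=> a x y; rewrite -[\val _]/(a *: \val x + \val y) (zmod_morphD DB) DZ.
  by have /eqP -> := ker_valP x; rewrite (klinear0 (der_klinear dd a)) addr0.
have [g gP] := ext (Hom (asboolT Dl)).
have gD f : free_cover M f = 0 -> g f = D f.
  by move=> /eqP f0; exact: (gP (Kernel f0)).
(* The left-hand side minus the first two terms on the right is the value of
   g at an element of the kernel, where g is D. *)
have gU a m m' : g << a *: m + m' >> = a *: g << m >> + g << m' >> - d a m.
  apply/eqP; rewrite [X in _ == X]addrC -subr_eq -hom_linear -homB gD; last first.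
    by rewrite homB hom_linear !free_coverU1 subrr.
  rewrite DB (zmod_morphD DB) free_scaleU !DU mulr1 !derivation1 //.
  by rewrite addr0 sub0r.
exists (fun m => g << m >>); split=> [c x y|a m].
  by rewrite gU (der_scalar dd) subr0.
have g0 : g << 0 >> = 0.
  have := gU 1 0 0; rewrite scaler0 addr0 derivation1 // subr0 scale1r => /eqP.
  by rewrite -[X in X == _]addr0 (inj_eq (addrI _)) eq_sym => /eqP.
have := gU a m 0; rewrite addr0 g0 addr0 => E.
by rewrite /inner_derivation E opprB addrC subrK.
Qed.

End Properties.

(** Let s be a section of the free cover of U, linear over the ground field,
  and p f = f - s (cover f) the induced projection onto the kernel.  For a map h
  on the kernel, d a u = h (p (a (s u))) measures the failure of h o p to be
  A-linear.  If d is inner through psi, then adding psi o cover to h o p repairs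
  it and does not change its restriction to the kernel. *)
Lemma derivations_inner_Ext_eq0 n (M N : lmodType A) :
  derivations_inner (syzygy n M) N -> forall x : Ext n.+1 M N, x = 0.
Proof.
set U := syzygy n M => inner; apply/Ext_eq0_extend => h.
have cl : klinear (free_cover U) by apply: linear_klinear; exact: hom_linear.
have [|s [sl sK]] := klinear_section cl.
  by move=> u; exists << u >>; exact: free_coverU1.
have pK f : in_ker (free_cover U) (f - s (free_cover U f)).
  by apply/eqP; rewrite homB sK subrr.
pose p f := Kernel (pK f).
have pE f : \val (p f) = f - s (free_cover U f) by [].
have pl : klinear p.
  move=> c x y; apply: val_inj.
  rewrite -[RHS]/(scalar_act c (\val (p x)) + \val (p y)).
  by rewrite !pE scalar_actBr cl sl opprD addrACA.
have pZ a f : p (a *: f) = a *: p f + p (a *: s (free_cover U f)).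
  apply: val_inj; rewrite -[RHS]/(a *: \val (p f) + \val (p (a *: s (free_cover U f)))).
  by rewrite !pE !homZ sK scalerBr addrA subrK.
have hl : klinear h by apply: linear_klinear; exact: hom_linear.
pose d a u := h (p (a *: s u)).
have ps u : p (s u) = 0 by apply: val_inj; rewrite pE sK subrr.
have dd : derivation d.
  split=> [a|u|c u|a b u]; rewrite /d.
  - apply: klinear_comp hl (klinear_comp pl _).
    exact: klinear_comp (klinear_scale _) sl.
  - by move=> a b; rewrite scalerBl (klinearB pl) homB.
  - by rewrite -/(scalar_act _ _) (klinearZ pl) ps scalar_act0 (klinear0 hl).
  - by rewrite -scalerA pZ homD !homZ sK.
have [psi [psil psiP]] := inner d dd.
exists (mk_hom (free_lift (fun u => psi u + h (p << u >>)))) => z.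
have liftE f : free_lift (fun u => psi u + h (p << u >>)) f =
    psi (free_cover U f) + h (p f).
  move: f; apply: malg_additive_eq => [|x y|b u]; first exact: free_liftB.
    rewrite (homB (free_cover U)) (klinearB psil) (klinearB pl) (homB h).
    by rewrite opprD addrACA.
  rewrite free_liftU free_coverU.
  have -> : << b *g u >> = b *: (<< u >> : free_module A U).
    by rewrite free_scaleU mulr1.
  have /eqP := psiP b u; rewrite /inner_derivation /d eq_sym subr_eq => /eqP E.
  rewrite scalerDr E (pZ b << u >>) homD homZ free_coverU1.
  by rewrite -addrA addrC -addrA.
rewrite /= liftE; have /eqP z0 := ker_valP z.
have -> : p (\val z) = z by apply: val_inj; rewrite pE z0 (klinear0 sl) subr0.
by rewrite z0 (klinear0 psil) add0r.
Qed.

End Derivation.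

(** * Derivations of a path algebra *)

(** Reduces the Leibniz rule to products of two paths.  It is stated for
  an arbitrary algebra because that keeps the scalars abstract: unfolding them
  in a path algebra is prohibitively slow. *)
Lemma leibniz_scale (k : fieldType) (A : algebra k) (M N : lmodType A)
    (d : A -> M -> N) (x y : A) (c e : k) :
  (forall b z m, d (alg_scalar A b * z) m = scalar_act b (d z m)) ->
  (forall z, klinear (d z)) ->
  (forall m, d (x * y) m = x *: d y m + d x (y *: m)) ->
  forall m, d (alg_scalar A c * x * (alg_scalar A e * y)) m =
    (alg_scalar A c * x) *: d (alg_scalar A e * y) m +
    d (alg_scalar A c * x) ((alg_scalar A e * y) *: m).
Proof.
move=> dZ dl dM m; have -> : alg_scalar A c * x * (alg_scalar A e * y) =
    alg_scalar A (c * e) * (x * y).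
  by rewrite rmorphM -!mulrA (mulrA x) -(alg_central e x) -mulrA.
rewrite !dZ dM !scalar_act_scale (klinearZ (dl x)) scale_scalar_act.
by rewrite scalar_actDr !scalar_actA.
Qed.

(** Locked: unification would otherwise compare two paths through the finitely
  supported functions that represent them. *)
HB.lock Definition path_element (k : fieldType) (Q : quiver) (p : qpath Q) :
  path_algebra k Q := (<< p >> : path_ring k Q).

Section PathDerivation.
Context (k : fieldType) (Q : quiver).
Local Notation A := (path_algebra k Q).
Local Notation path_element := (@path_element k Q).

Definition vertex_element (i : vertex Q) : A := path_element (trivial_path i).

Fact arrow_walk (a : arrow Q) : is_walk (source a) [:: a].
Proof. by rewrite /= eqxx. Qed.

Definition arrow_path (a : arrow Q) : qpath Q :=
  @QPath Q (source a, [:: a]) (arrow_walk a).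

Definition arrow_element (a : arrow Q) : A := path_element (arrow_path a).

Lemma path_elementM p q : path_element p * path_element q =
  if path_comp p q is Some r then path_element r else 0.
Proof.
rewrite unlock [LHS](path_mulUU (1 : k) 1 p q) mulr1.
by case: (path_comp p q) => // r; rewrite unlock.
Qed.

Lemma vertex_elementM i j :
  vertex_element i * vertex_element j = if i == j then vertex_element i else 0.
Proof.
rewrite /vertex_element path_elementM trivial_path_comp eq_sym.
by case: eqP => [->|].
Qed.

Lemma vertex_element_sum : \sum_i vertex_element i = 1.
Proof. by apply: eq_bigr => i _; rewrite /vertex_element unlock. Qed.

Lemma vertex_path_element p :
  vertex_element (path_target p) * path_element p = path_element p.
Proof. by rewrite path_elementM trivial_path_comp eqxx. Qed.

Lemma path_vertex_element p :
  path_element p * vertex_element (path_source p) = path_element p.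
Proof. by rewrite path_elementM path_comp_trivial eqxx. Qed.

Lemma target_arrow_element a :
  vertex_element (target a) * arrow_element a = arrow_element a.
Proof. exact: vertex_path_element (arrow_path a). Qed.

Lemma arrow_source_element a :
  arrow_element a * vertex_element (source a) = arrow_element a.
Proof. exact: path_vertex_element (arrow_path a). Qed.

Lemma path_algebra_additive_eq (B : zmodType) (f g : A -> B) :
  zmod_morphism f -> zmod_morphism g ->
  (forall c p, f (alg_scalar A c * path_element p) =
               g (alg_scalar A c * path_element p)) -> f =1 g.
Proof.
move=> fB gB fg; apply: (@malg_additive_eq _ _ _ f g) => // c p.
have -> // : << c *g p >> = alg_scalar A c * path_element p.
rewrite /= /path_scalar -path_scaleAl mul1r unlock.
by rewrite [RHS](free_scaleU c (1 : k) p) mulr1.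
Qed.

(** The arrows of a path are listed in the order of their traversal, whereas
  their product in the algebra starts with the last one. *)
Fixpoint arrow_word (s : seq (arrow Q)) : A :=
  if s is a :: s' then arrow_word s' * arrow_element a else 1.

Lemma arrow_word_cat s t : arrow_word (s ++ t) = arrow_word t * arrow_word s.
Proof. by elim: s => /= [|a s ->]; rewrite ?mulr1 ?mulrA. Qed.

Lemma path_element_word p :
  path_element p = arrow_word (path_arrows p) * vertex_element (path_source p).
Proof.
case: p => -[i s] /= w; rewrite /path_arrows /path_source /=.
elim: s i w => [|a s IHs] i w.
  by rewrite mul1r; congr path_element; exact: path_ext.
have /andP[/eqP ai ws] := w; subst i; rewrite /= -mulrA arrow_source_element.
rewrite -[arrow_element a in RHS]target_arrow_element mulrA -(IHs _ ws) path_elementM.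
case: path_compP => [r _ rs _ ra|[]]; last by rewrite /path_target.
by congr path_element; apply: path_ext; rewrite ?rs ?ra.
Qed.

(** The elements on which a derivation vanishes form a subalgebra, and the
  vertices and the arrows generate the path algebra. *)
Lemma path_derivation_eq0 (M N : lmodType A) (d : A -> M -> N) :
  derivation d -> (forall i m, d (vertex_element i) m = 0) ->
  (forall a m, d (arrow_element a) m = 0) -> forall x m, d x m = 0.
Proof.
move=> dd dv da x m; move: x.
apply: (@path_algebra_additive_eq N (d^~ m) (fun=> 0)) => [|x y|c p].
- exact: der_additive dd m.
- by rewrite subrr.
have dM x y : (forall u, d x u = 0) -> (forall u, d y u = 0) ->
    forall u, d (x * y) u = 0.
  by move=> dx dy u; rewrite (der_mul dd) dx dy scaler0 addr0.
apply: (dM) => [u|]; first exact: der_scalar dd c u.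
rewrite path_element_word; apply: (dM) => //.
elim: (path_arrows p) => [|a s IHs] u /=; first exact: derivation1 dd.
by apply: dM u => [u|u]; [exact: IHs | exact: da].
Qed.

Section Generate.
Context (M N : lmodType A) (D : arrow Q -> M -> N).
Hypothesis Dl : forall a, klinear (D a).

(** The part of D a that a derivation vanishing on the vertices can see. *)
Definition corner_map (a : arrow Q) (m : M) : N :=
  vertex_element (target a) *: D a (vertex_element (source a) *: m).

(** Leibniz's rule along a path. *)
Fixpoint word_derivation (s : seq (arrow Q)) (m : M) : N :=
  if s is a :: s' then
    word_derivation s' (arrow_element a *: m) + arrow_word s' *: corner_map a m
  else 0.

Definition path_derivation (x : A) (m : M) : N :=
  msum (fun p c => scalar_act c
    (word_derivation (path_arrows p) (vertex_element (path_source p) *: m))) x.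

Lemma corner_map_klinear a : klinear (corner_map a).
Proof.
apply: klinear_comp (klinear_scale _) _.
exact: klinear_comp (Dl a) (klinear_scale _).
Qed.

Lemma word_derivation_klinear s : klinear (word_derivation s).
Proof.
elim: s => [|a s IHs] /=; first by move=> c x y; rewrite scalar_act0 addr0.
apply: klinear_add; first exact: klinear_comp IHs (klinear_scale _).
exact: klinear_comp (klinear_scale _) (corner_map_klinear a).
Qed.

Lemma word_derivation_cat s t m : word_derivation (s ++ t) m =
  word_derivation t (arrow_word s *: m) + arrow_word t *: word_derivation s m.
Proof.
elim: s m => [|a s IHs] m /=; first by rewrite scale1r scaler0 addr0.
by rewrite IHs arrow_word_cat scalerDr !scalerA addrA.
Qed.

Lemma word_derivation_target i s m : is_walk i s ->
  vertex_element (last i (map (@target Q) s)) *: word_derivation s m =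
  word_derivation s m.
Proof.
elim: s i m => [|a s IHs] i m /=; first by rewrite scaler0.
move=> /andP[_ ws]; rewrite scalerDr IHs //; congr (_ + _).
rewrite -[corner_map a m]/(vertex_element _ *: _) !scalerA -!mulrA.
have := path_element_word (@QPath Q (target a, s) ws).
rewrite /path_arrows /path_source /= => <-.
by rewrite (vertex_path_element (@QPath Q (target a, s) ws)).
Qed.

Lemma path_derivationU p m : path_derivation (path_element p) m =
  word_derivation (path_arrows p) (vertex_element (path_source p) *: m).
Proof. by rewrite unlock /path_derivation msumU ?scalar_act0l // scalar_act1. Qed.

Lemma path_derivationB m : zmod_morphism (path_derivation^~ m).
Proof.
apply: msum_is_zmod_morphism => p c d.
by rewrite /scalar_act rmorphB scalerBl.
Qed.

Lemma path_derivationZ c x m :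
  path_derivation (alg_scalar A c * x) m = scalar_act c (path_derivation x m).
Proof.
move: x; apply: path_algebra_additive_eq => [x y|x y|d p].
- by rewrite mulrBr path_derivationB.
- by rewrite path_derivationB scalar_actBr.
have E e : path_derivation (alg_scalar A e * path_element p) m =
    scalar_act e (word_derivation (path_arrows p) (vertex_element (path_source p) *: m)).
  rewrite /= /path_scalar -path_scaleAl mul1r unlock.
  rewrite [e *: _](free_scaleU e (1 : k) p) mulr1.
  by rewrite /path_derivation msumU ?scalar_act0l.
rewrite (mulrA (alg_scalar A c) (alg_scalar A d) (path_element p)).
rewrite -(rmorphM (alg_scalar A) c d).
by rewrite [LHS](E (c * d)) [in RHS](E d) scalar_actA.
Qed.

Lemma path_derivation_klinear x : klinear (path_derivation x).
Proof.
move=> c m m'; move: x; apply: path_algebra_additive_eq => [x y|x y|d p].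
- by rewrite path_derivationB.
- by rewrite !path_derivationB scalar_actBr opprD addrACA.
rewrite !path_derivationZ !path_derivationU.
rewrite scalerDr scale_scalar_act word_derivation_klinear.
by rewrite scalar_actDr !scalar_actA mulrC.
Qed.

Lemma path_derivation_mulU p q m :
  path_derivation (path_element p * path_element q) m =
  path_element p *: path_derivation (path_element q) m +
  path_derivation (path_element p) (path_element q *: m).
Proof.
rewrite (path_derivationU p) (path_derivationU q).
rewrite (scalerA (vertex_element _) (path_element q)).
have vqE u : word_derivation (path_arrows q) u =
  vertex_element (path_target q) *: word_derivation (path_arrows q) u.
  by rewrite (word_derivation_target _ (path_valP q)).
rewrite (path_elementM p q); case: path_compP => [r pq rs _ ra|pq].
  rewrite path_derivationU rs ra word_derivation_cat -pq vertex_path_element.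
  rewrite (scalerA (arrow_word _)) -path_element_word addrC; congr (_ + _).
  by rewrite (path_element_word p) -scalerA -pq -vqE.
have /negbTE pq0 : path_source p != path_target q by apply/eqP => /esym.
rewrite vqE scalerA (path_element_word p) -mulrA vertex_elementM pq0 mulr0.
rewrite -(vertex_path_element q) mulrA vertex_elementM pq0 mul0r !scale0r add0r.
rewrite (klinear0 (word_derivation_klinear _)).
exact: zmod_morph0 (path_derivationB m).
Qed.

Lemma path_derivation_vertex i m : path_derivation (vertex_element i) m = 0.
Proof. by rewrite path_derivationU. Qed.

Lemma path_derivation_arrow a m :
  path_derivation (arrow_element a) m = corner_map a m.
Proof.
rewrite path_derivationU /= add0r scale1r /corner_map scalerA.
by rewrite vertex_elementM eqxx.
Qed.

(** Arbitrary values on the arrows extend to a derivation: this freeness is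
  what makes path algebras hereditary. *)
Lemma path_derivationP : derivation path_derivation.
Proof.
have dB := path_derivationB; have dl := path_derivation_klinear.
split=> // [c m|x y m].
  rewrite -[alg_scalar A c]mulr1 path_derivationZ -vertex_element_sum.
  rewrite (zmod_morph_sum (dB m)) big1 ?scalar_act0 // => i _.
  exact: path_derivation_vertex.
move: x; apply: path_algebra_additive_eq => [x x'|x x'|c p].
- by rewrite mulrBl dB.
- by rewrite scalerBl !dB opprD addrACA.
move: y; apply: path_algebra_additive_eq => [y y'|y y'|e q].
- by rewrite mulrBr dB.
- by rewrite scalerBl (klinearB (dl _)) dB scalerBr opprD addrACA.
apply: (@leibniz_scale k A M N path_derivation) => [b z u|z|u].
- exact: path_derivationZ.
- exact: dl.
- exact: path_derivation_mulU.
Qed.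

End Generate.

(** Once a derivation vanishes on the vertices, its value on an arrow is
  concentrated between the two ends of that arrow. *)
Lemma derivation_arrow_corner (M N : lmodType A) (d : A -> M -> N) a m :
  derivation d -> (forall i u, d (vertex_element i) u = 0) ->
  vertex_element (target a) *: d (arrow_element a) (vertex_element (source a) *: m) =
  d (arrow_element a) m.
Proof.
move=> dd dv; rewrite -[in RHS]target_arrow_element -[in RHS]arrow_source_element.
by rewrite !(der_mul dd) !dv addr0 scaler0 add0r.
Qed.

(** Heredity.  Composing the values of d on the arrows with a k-linear
  retraction of M onto K gives values on the arrows for a derivation on M, and
  that derivation restricts to d on K because it does so on the generators. *)
Lemma derivations_inner_sub (K M N : lmodType A) (i : hom K M) : injective i ->
  derivations_inner M N -> derivations_inner K N.
Proof.
move=> iI inner.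
apply: (derivations_inner_normalised vertex_elementM vertex_element_sum).
move=> d dd dv.
have [|r [rl rK]] := klinear_retraction _ iI.
  by apply: linear_klinear; exact: hom_linear.
pose D a m := d (arrow_element a) (r m).
have Dl a : klinear (D a) by exact: klinear_comp (der_klinear dd _) rl.
have d'd := path_derivationP Dl.
have [psi [psil psiP]] := inner _ d'd; exists (psi \o i).
have psiil : klinear (psi \o i).
  by apply: klinear_comp psil (linear_klinear (hom_linear i)).
split=> // x m; apply/eqP; rewrite -subr_eq0; apply/eqP; move: x m.
have iE x m : inner_derivation (psi \o i) x m = path_derivation D x (i m).
  by rewrite psiP /inner_derivation /= homZ.
apply: path_derivation_eq0 => [|j m|a m].
- exact: derivation_sub dd (inner_derivationP psiil).
- by rewrite dv iE path_derivation_vertex subrr.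
rewrite iE path_derivation_arrow /corner_map /D -homZ rK.
by rewrite (derivation_arrow_corner a m dd dv) subrr.
Qed.

End PathDerivation.

(** * Derivations of a one-point extension *)

Section OnePointDerivation.
Context (k : fieldType) (A : algebra k) (T : lmodType A).
Local Notation B := (one_point_extension T).

Definition corner_alg (b : B) : A := (b : opext T).1.1.
Definition corner_mod (b : B) : T := (b : opext T).1.2.
Definition corner_scal (b : B) : k := (b : opext T).2.

Definition alg_idem : B := opmx 1 0 0.
Definition vec_idem : B := opmx 0 0 1.

Let opsimp := (mul1r, mulr1, mul0r, mulr0, scaler0, scale0r, scale1r,
  scalar_act0, scalar_act0l, scalar_act1, addr0, add0r).

Section Parts.
Context (X : lmodType B).
Implicit Types (x : X) (a : A) (t : T) (l : k).

Lemma opact_scalar c x : scalar_act c x = opact (alg_scalar A c) 0 c x.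
Proof. by []. Qed.

Lemma opact_klinear a t l : klinear (@opact k A T X a t l).
Proof. exact: klinear_scale. Qed.

Fact algebra_proj_subproof x : in_algebra_part (opact 1 0 0 x).
Proof. by apply/eqP; rewrite opact_comp !opsimp. Qed.

Definition algebra_proj x : algebra_part X :=
  AlgebraPart (algebra_proj_subproof x).

Fact corner_act_subproof t x : in_algebra_part (opact 0 t 0 x).
Proof. by apply/eqP; rewrite opact_comp !opsimp. Qed.

(** The corner map, extended by zero to all of X so that no projection onto the
  vector part is required. *)
Definition corner_act t x : algebra_part X :=
  AlgebraPart (corner_act_subproof t x).

Definition vector_proj x : X := opact 0 0 1 x.

Lemma algebra_projK (y : algebra_part X) : algebra_proj (\val y) = y.
Proof. by apply: val_inj; exact/eqP/algebra_partP. Qed.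

Lemma algebra_part_scale a (y : algebra_part X) :
  \val (a *: y) = opact a 0 0 (\val y).
Proof. by []. Qed.

(** On the algebra part, only the A-coefficient of a matrix matters. *)
Lemma opact_algebra_part a t l (y : algebra_part X) :
  opact a t l (\val y) = \val (a *: y).
Proof.
by rewrite algebra_part_scale -{1}[y]algebra_projK opact_comp !opsimp
  -{2}[y]algebra_projK opact_comp !opsimp.
Qed.

Lemma algebra_part_klinear : klinear (\val : algebra_part X -> X).
Proof.
by move=> c x y; rewrite opact_scalar opact_algebra_part.
Qed.

Lemma algebra_proj_opact a t l x :
  algebra_proj (opact a t l x) = a *: algebra_proj x + corner_act t x.
Proof.
apply: val_inj; rewrite -[RHS]/(opact a 0 0 (opact 1 0 0 x) + opact 0 t 0 x).
by rewrite /= !opact_comp -opactDl !opsimp.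
Qed.

Lemma algebra_projB : zmod_morphism algebra_proj.
Proof. by move=> x y; apply: val_inj; exact: opactB. Qed.

Lemma corner_act0 x : corner_act 0 x = 0.
Proof. by apply: val_inj; exact: scale0r. Qed.

Lemma algebra_proj_klinear : klinear algebra_proj.
Proof.
move=> c x y; rewrite (zmod_morphD algebra_projB) opact_scalar.
by rewrite algebra_proj_opact corner_act0 addr0.
Qed.

Lemma corner_actBl x : zmod_morphism (corner_act^~ x).
Proof.
move=> t u; apply: val_inj; rewrite -[RHS]/(opact 0 t 0 x - opact 0 u 0 x) /=.
by rewrite /opact -scalerBl; congr (_ *: _); congr opmx; rewrite subr0.
Qed.

Lemma corner_act_klinear t : klinear (corner_act t).
Proof.
move=> c x y; apply: val_inj; rewrite /= opact_klinear; congr (_ + _).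
by rewrite !opact_scalar !opact_comp !opsimp.
Qed.

Lemma corner_actZ a t x : corner_act (a *: t) x = a *: corner_act t x.
Proof. by apply: val_inj; rewrite algebra_part_scale /= opact_comp !opsimp. Qed.

Lemma corner_act_vector t x : corner_act t (vector_proj x) = corner_act t x.
Proof. by apply: val_inj; rewrite /= opact_comp !opsimp. Qed.

Lemma corner_act_linear x : linear (corner_act^~ x).
Proof.
by move=> a t u; rewrite (zmod_morphD (corner_actBl x)) corner_actZ.
Qed.

End Parts.

Lemma algebra_part_hom (X Y : lmodType B) (i : hom X Y) : injective i ->
  exists j : hom (algebra_part X) (algebra_part Y), injective j.
Proof.
move=> iI; pose j (y : algebra_part X) := algebra_proj (i (\val y)).
have iE a t l x : i (opact a t l x) = opact a t l (i x) by exact: homZ.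
have jl : linear j.
  move=> a x y; rewrite /j -[\val (_ + _)]/(opact a 0 0 (\val x) + \val y).
  rewrite homD iE (zmod_morphD (@algebra_projB Y)) algebra_proj_opact.
  by rewrite corner_act0 addr0.
exists (Hom (asboolT jl)) => x y /(congr1 \val); rewrite /= -!iE => /iI xy.
by rewrite -[x]algebra_projK -[y]algebra_projK; exact: val_inj.
Qed.

Lemma opact_freeU (K : choiceType) a t l b (x : K) :
  opact a t l (<< b *g x >> : free_module B K) =
  << (opmx (a * corner_alg b) (a *: corner_mod b + scalar_act (corner_scal b) t)
       (l * corner_scal b) : B) *g x >>.
Proof. by rewrite /opact free_scaleU; case: b => -[]. Qed.

(** The algebra part of a free module is a sum of copies of A and of T.  On the
  copy of A generated by E x, a derivation d is inner through b |-> - d b (E x). *)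
Lemma derivations_inner_free (K : choiceType) (N : lmodType A) :
  derivations_inner T N -> derivations_inner (algebra_part (free_module B K)) N.
Proof.
move=> inner d dd; set F := free_module B K.
pose E (x : K) := algebra_proj (<< x >> : F).
pose C (x : K) t := corner_act t (<< x >> : F).
have Clin x : linear (C x) by exact: corner_act_linear.
have /choice[psi psiP] x : exists psi, klinear psi /\
    forall a t, d a (C x t) = inner_derivation psi a t.
  exact: inner (derivation_comp (Hom (asboolT (Clin x))) dd).
have psil x := (psiP x).1; have {}psiP x := (psiP x).2.
pose psi0 (f : F) : N :=
  msum (fun x b => psi x (corner_mod b) - d (corner_alg b) (E x)) f.
have psi0B : zmod_morphism psi0.
  apply: msum_is_zmod_morphism => x b c.
  rewrite -[corner_mod _]/(corner_mod b - corner_mod c).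
  rewrite -[corner_alg _]/(corner_alg b - corner_alg c).
  by rewrite (klinearB (psil x)) derivationB // !opprD addrACA.
have psi0U b x :
    psi0 << b *g x >> = psi x (corner_mod b) - d (corner_alg b) (E x).
  rewrite /psi0 msumU // -[corner_mod 0]/(0 : T) -[corner_alg 0]/(0 : A).
  by rewrite (klinear0 (psil x)) derivation0 // subrr.
have freeE b x : algebra_proj (<< b *g x >> : F) =
    corner_alg b *: E x + C x (corner_mod b).
  rewrite -(algebra_proj_opact _ _ (corner_scal b)) opact_freeU.
  rewrite -[corner_alg 1]/(1 : A) -[corner_mod 1]/(0 : T) -[corner_scal 1]/(1 : k).
  by rewrite !opsimp; case: b => -[].
have psi0Z c f : psi0 (scalar_act c f) = scalar_act c (psi0 f).
  move: f; apply: malg_additive_eq => [f g|f g|b x].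
  - by rewrite scalar_actBr psi0B.
  - by rewrite psi0B scalar_actBr.
  rewrite opact_scalar opact_freeU !psi0U scalar_actBr.
  rewrite -[corner_mod (opmx _ _ _)]/(_ + _) -[corner_alg (opmx _ _ _)]/(_ * _).
  by rewrite !opsimp derivationZ // -/(scalar_act c _) (klinearZ (psil x)).
exists (psi0 \o \val); split.
  move=> c x y; rewrite [LHS]/comp algebra_part_klinear (zmod_morphD psi0B).
  by rewrite psi0Z.
move=> a y; rewrite -{1}[y]algebra_projK /inner_derivation /comp algebra_part_scale.
move: (\val y); apply: malg_additive_eq => [f g|f g|b x].
- by rewrite algebra_projB (klinearB (der_klinear dd a)).
- by rewrite opactB !psi0B scalerBr !opprD addrACA.
rewrite freeE (klinearD (der_klinear dd a)) psiP opact_freeU !psi0U.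
rewrite -[corner_mod (opmx _ _ _)]/(_ + _) -[corner_alg (opmx _ _ _)]/(_ * _).
rewrite !opsimp (der_mul dd) scalerBr /inner_derivation.
have addr_cancel (V : zmodType) (u v w z : V) :
    u + (v - w) = v - z - (w - (z + u)).
  by rewrite [in RHS]opprB -!addrA addKr addrCA.
exact: addr_cancel.
Qed.

(** Let O be a submodule of a free module, with algebra part L and vector part
  U.  If the restriction to L of a derivation d is inner through psi0, then the
  expressions g t u = psi0 (t u) + d t u, for u in U, are A-linear in t.  The
  derivation d is inner as soon as some A-linear map w on L satisfies
  w (t u) = g t u: then psi0 - w, extended by zero to U, does it.  Such a w exists
  because the multiplication from T (x) U to L is split injective inside a free
  module: there it is enough to retract the vector part of the free module onto U
  and to apply g to the T-coordinates. *)
Lemma derivations_inner_glue (K : choiceType) (O Y : lmodType B)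
    (i : hom O (free_module B K)) : injective i ->
  derivations_inner (algebra_part O) (algebra_part Y) -> derivations_inner O Y.
Proof.
move=> iI inner; set F := free_module B K in i iI *.
pose eps (b : bool) := if b then alg_idem else vec_idem.
have idem1 : \sum_b eps b = 1.
  by rewrite big_bool /=; congr opmx; rewrite ?addr0 ?add0r.
apply: (derivations_inner_normalised _ idem1) => [[] []|d dd deps] /=;
  try by rewrite /alg_idem /vec_idem opmxM !opsimp.
have de m : d alg_idem m = 0 := deps true m.
have dv m : d vec_idem m = 0 := deps false m.
have dl := der_klinear dd.
pose dA a (y : algebra_part O) := algebra_proj (d (opmx a 0 0) (\val y)).
have dAd : derivation dA.
  split=> [a|y a b|c y|a b y].
  - exact: klinear_comp (@algebra_proj_klinear Y)
      (klinear_comp (dl _) (@algebra_part_klinear O)).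
  - rewrite /dA -algebra_projB -derivationB //; congr (algebra_proj (d _ _)).
    by congr opmx; rewrite subr0.
  - rewrite /dA; have -> : opmx (alg_scalar A c) 0 0 = alg_scalar B c * alg_idem.
      by rewrite /alg_idem opmxM !opsimp.
    by rewrite derivationZ // -/alg_idem de scalar_act0; apply: val_inj; exact: scaler0.
  - rewrite /dA; have -> : opmx (a * b) 0 0 = (opmx a 0 0 : B) * opmx b 0 0.
      by rewrite opmxM !opsimp.
    rewrite (der_mul dd) (zmod_morphD (@algebra_projB Y)).
    rewrite -[X in algebra_proj X + _]/(opact a 0 0 _) algebra_proj_opact.
    by rewrite corner_act0 addr0.
have dA_val a y : \val (dA a y) = d (opmx a 0 0) (\val y).
  rewrite -[LHS]/(alg_idem *: _); have := der_mul dd alg_idem (opmx a 0 0) (\val y).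
  by rewrite de addr0 => <-; rewrite opmxM !opsimp.
have [psi0 [psi0l psi0P]] := inner dA dAd.
have [r [rl rK]] := klinear_retraction (linear_klinear (hom_linear i)) iI.
pose g t (u : O) : Y := \val (psi0 (corner_act t u)) + d (opmx 0 t 0) u.
have gB u : zmod_morphism (g^~ u).
  move=> t t'; rewrite /g corner_actBl (klinearB psi0l).
  have -> : opmx 0 (t - t') 0 = (opmx 0 t 0 : B) - opmx 0 t' 0.
    by congr opmx; rewrite subr0.
  by rewrite derivationB // opprD addrACA.
have gl t : klinear (g t).
  apply: klinear_add (dl _).
  exact: klinear_comp (@algebra_part_klinear Y)
    (klinear_comp psi0l (@corner_act_klinear O t)).
have gZ a t u : vector_proj u = u -> g (a *: t) u = opact a 0 0 (g t u).
  move=> uv; rewrite /g corner_actZ [RHS](zmod_morphD (opactB _ _ _)).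
  have -> : opmx 0 (a *: t) 0 = (opmx a 0 0 : B) * opmx 0 t 0.
    by rewrite opmxM !opsimp.
  rewrite (der_mul dd) -/(opact a 0 0 (d _ _)) opact_algebra_part.
  have := dA_val a (corner_act t u); rewrite psi0P /inner_derivation.
  rewrite (klinearB (@algebra_part_klinear Y)) => /eqP.
  rewrite subr_eq addrC => /eqP ->.
  by rewrite [X in _ + X]addrC addrA.
have gS c t u : g (scalar_act c t) u = scalar_act c (g t u).
  rewrite /g scalar_actDr -(klinearZ (@algebra_part_klinear Y)) -(klinearZ psi0l).
  rewrite -derivationZ // corner_actZ; congr (_ + d _ u).
  by rewrite opmxM !opsimp.
(* Here w is defined on the whole free module, and vanishes on the vector part
   because the T-coordinates do. *)
pose w (f : F) : Y :=
  msum (fun x b => g (corner_mod b) (vector_proj (r (vector_proj (<< x >> : F))))) f.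
pose rho f : O := vector_proj (r (vector_proj f)).
have wB : zmod_morphism w.
  by apply: msum_is_zmod_morphism => x b c; exact: gB.
have wU b x : w << b *g x >> = g (corner_mod b) (rho << x >>).
  by rewrite /w msumU // (zmod_morph0 (gB _)).
have rhol : klinear rho.
  exact: klinear_comp (@opact_klinear _ _ _ _)
    (klinear_comp rl (@opact_klinear _ _ _ _)).
have rhov f : vector_proj (rho f) = rho f.
  by rewrite /rho /vector_proj opact_comp !opsimp.
have rhoU b x : rho << b *g x >> = scalar_act (corner_scal b) (rho << x >>).
  rewrite -(klinearZ rhol) /rho; congr (vector_proj (r _)).
  rewrite /vector_proj opact_scalar !opact_freeU.
  rewrite -[corner_alg 1]/(1 : A) -[corner_mod 1]/(0 : T) -[corner_scal 1]/(1 : k).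
  by rewrite /corner_alg /corner_mod /corner_scal /= !opsimp.
(* The case (a, t, l) = (1, 0, 1) shows that the values of w lie in the algebra
   part, the case (a, 0, 0) that w is A-linear, and the case (0, t, 0) that w
   takes the prescribed values. *)
have wE a t l f : w (opact a t l f) = opact a 0 0 (w f) + g t (rho f).
  have lhsB : zmod_morphism (fun f => w (opact a t l f)).
    by move=> f1 f2; rewrite opactB wB.
  have rhsB : zmod_morphism (fun f => opact a 0 0 (w f) + g t (rho f)).
    move=> f1 f2; rewrite wB opactB (klinearB rhol) (klinearB (gl t)).
    by rewrite [in RHS]opprD addrACA.
  move: f; apply: (malg_additive_eq lhsB rhsB) => b x.
  rewrite opact_freeU !wU rhoU -[corner_mod (opmx _ _ _)]/(_ + _).
  by rewrite (zmod_morphD (gB _)) gZ // (klinearZ (gl t)) gS.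
have rhoi z : rho (i z) = vector_proj z.
  by rewrite /rho /vector_proj /opact -homZ rK -/(opact _ _ _ _) opact_comp !opsimp.
have w_opact a t l f : opact a t l (w f) = opact a 0 0 (w f).
  have w_alg : opact 1 0 0 (w f) = w f.
    have := wE 1 0 1 f; rewrite (zmod_morph0 (gB _)) addr0 => <-.
    by rewrite [opact 1 0 1 f]scale1r.
  by rewrite -w_alg !opact_comp !opsimp.
exists (fun z => \val (psi0 (algebra_proj z)) - w (i z)); split.
  apply: klinear_sub.
    exact: klinear_comp (@algebra_part_klinear Y)
      (klinear_comp psi0l (@algebra_proj_klinear O)).
  move=> c x y; rewrite (linear_klinear (hom_linear i)) (zmod_morphD wB).
  by rewrite !opact_scalar wE (zmod_morph0 (gB _)) addr0 w_opact.
move=> b z; case: b => -[a t] l; rewrite -[(a, t, l)]/(opmx a t l : B).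
have dE : d (opmx a t l) z = d (opmx a 0 0) z + d (opmx 0 t 0) z.
  have -> : opmx a t l =
      (opmx a 0 0 : B) + opmx 0 t 0 + alg_scalar B l * vec_idem.
    rewrite /vec_idem opmxM !opsimp.
    by rewrite -[RHS]/(opmx (a + 0 + 0) (0 + t + 0) (0 + 0 + l)) !opsimp.
  by rewrite !derivationD // derivationZ // dv scalar_act0 addr0.
have daE : d (opmx a 0 0) z =
    \val (a *: psi0 (algebra_proj z)) - \val (psi0 (a *: algebra_proj z)).
  rewrite -(klinearB (@algebra_part_klinear Y)).
  rewrite -[_ - _]/(inner_derivation psi0 a _) -psi0P dA_val.
  rewrite -[\val (algebra_proj z)]/(alg_idem *: z).
  have := der_mul dd (opmx a 0 0) alg_idem z; rewrite de scaler0 add0r => <-.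
  by rewrite opmxM !opsimp.
have dtE : d (opmx 0 t 0) z = d (opmx 0 t 0) (vector_proj z).
  have := der_mul dd (opmx 0 t 0) vec_idem z; rewrite dv scaler0 add0r => <-.
  by rewrite opmxM !opsimp.
have psi0D : psi0 (algebra_proj (opact a t l z)) =
    psi0 (a *: algebra_proj z) + psi0 (corner_act t z).
  by rewrite algebra_proj_opact (klinearD psi0l).
have wiE : w (i (opact a t l z)) = opact a 0 0 (w (i z)) +
    (\val (psi0 (corner_act t z)) + d (opmx 0 t 0) z).
  rewrite {1}/opact homZ -/(opact _ _ _ _) wE rhoi /g -dtE.
  by rewrite corner_act_vector.
rewrite /inner_derivation -[_ *: z]/(opact a t l z) psi0D wiE.
rewrite (klinearD (@algebra_part_klinear Y)) dE daE.
rewrite -[_ *: (_ - _)]/(opact a t l (_ - _)) opactB opact_algebra_part w_opact.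
have cancel6 (P q S D W : Y) : P - q + D = P - W - (q + S - (W + (S + D))).
  rewrite (addrCA W S D) [- (S + _)]opprD addrA addrK opprB -(addrA W).
  by rewrite (addrA (P - W) W) subrK addrAC addrA.
exact: cancel6.
Qed.

(** When Y is full, its algebra part is a quotient of a sum of copies of T
  indexed by its vector part; the coordinates are those of a lift that is
  linear over the ground field only. *)
Lemma full_coordinates (Y : lmodType B) : full Y ->
  exists coord : vector_part Y -> algebra_part Y -> T,
    [/\ forall w, klinear (coord w),
        forall y, exists l : seq (vector_part Y), forall w, w \notin l -> coord w y = 0
      & forall y l, uniq l -> (forall w, w \notin l -> coord w y = 0) ->
          y = \sum_(w <- l) corner_act (coord w y) (\val w)].
Proof.
move=> Yfull; set F := free_module B (vector_part Y).
pose theta (f : F) : algebra_part Y :=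
  msum (fun w b => corner_act (corner_mod b) (\val w)) f.
have thetaB : zmod_morphism theta.
  by apply: msum_is_zmod_morphism => w b c; exact: corner_actBl.
have thetaU b w : theta << b *g w >> = corner_act (corner_mod b) (\val w).
  by rewrite /theta msumU //; exact: corner_act0.
have thetaZ c f : theta (scalar_act c f) = scalar_act c (theta f).
  move: f; apply: malg_additive_eq => [f g|f g|b w].
  - by rewrite scalar_actBr thetaB.
  - by rewrite thetaB scalar_actBr.
  rewrite opact_scalar opact_freeU !thetaU -[corner_mod (opmx _ _ _)]/(_ + _).
  by rewrite scalar_act0 addr0 corner_actZ.
have thetal : klinear theta by move=> c x y; rewrite (zmod_morphD thetaB) thetaZ.
have theta_surj y : exists f, theta f = y.
  have [u <-] := Yfull y; rewrite -[u]reprK -/(tensor_pi _).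
  move: (repr u) => z; rewrite /structure_map (tensor_lift_pi (corner_balanced Y)).
  pose lift t w : F := << (opmx 0 t 0 : B) *g w >>.
  exists (tensor_ext lift z).
  have liftB := tensor_extB lift.
  move: z; apply: malg_additive_eq => [x x'|x x'|n [t w]].
  - by rewrite liftB thetaB.
  - exact: tensor_extB.
  rewrite /tensor_ext !msumU //= (zmod_morph_mulz thetaB) thetaU.
  by congr (_ *~ _); apply: val_inj.
have [s [sl sK]] := klinear_section thetal theta_surj.
exists (fun w y => corner_mod (mcoeff w (s y))); split=> [w c x y|y|y l lu l0].
- rewrite sl mcoeffD free_coeffZ -[corner_mod (_ + _)]/(_ + _); congr (_ + _).
  case: (mcoeff w (s x)) => -[a t] l.
  by rewrite -[LHS]/(alg_scalar A c *: t + scalar_act l 0) scalar_act0 addr0.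
- by exists (msupp (s y)) => w wy; rewrite mcoeff_outdom.
rewrite -{1}[y]sK /theta /msum [RHS](bigID (mem (msupp (s y)))) /=.
rewrite [X in _ = _ + X]big1 => [|w wy]; last first.
  by rewrite mcoeff_outdom //; exact: corner_act0.
rewrite addr0 [LHS](bigID (mem l)) /= [X in _ + X = _]big1 => [|w wl]; last first.
  by rewrite l0 // corner_act0.
rewrite addr0 -[LHS]big_filter -[RHS]big_filter; apply: perm_big.
apply: uniq_perm => [||w]; [exact/filter_uniq/fset_uniq | exact: filter_uniq |].
by rewrite !mem_filter andbC.
Qed.

End OnePointDerivation.

(** * Full modules over the one-point extension of a path algebra *)

Section FullPathModules.
Context (k : fieldType) (Q : quiver).
Local Notation A := (path_algebra k Q).
Context (T : lmodType A).
Local Notation B := (one_point_extension T).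

(** The algebra part of Y is a quotient of a sum of copies of T.  The values of d
  on the arrows, read in the coordinates indexed by the vector part of Y, are the
  values on the arrows of derivations from T to T, which are inner; their
  potentials psi w recombine into a potential for d.  Finite dimension of T makes
  almost all coordinates vanish, so that the recombination is a finite sum. *)
Lemma derivations_inner_full (Y : lmodType B) : finite_dimensional T ->
  derivations_inner T T -> full Y -> derivations_inner T (algebra_part Y).
Proof.
move=> [s sP] inner /full_coordinates[coord [coordl coord_fin coordE]].
apply: (derivations_inner_normalised (@vertex_elementM k Q)).
  exact: vertex_element_sum.
move=> d dd dv; have dl := der_klinear dd.
have /choice[supp suppP] := coord_fin.
pose ds : seq (algebra_part Y) :=
  [seq d (arrow_element k a) t | a <- enum (arrow Q), t <- s].
pose l := undup (flatten (map supp ds)).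
have coord0 a m w : w \notin l -> coord w (d (arrow_element k a) m) = 0.
  move=> wl; have [c ->] := sP m.
  rewrite (zmod_morph_sum (klinearB (dl _))).
  rewrite (zmod_morph_sum (klinearB (coordl w))) big1 // => j _.
  rewrite (klinearZ (dl _)) (klinearZ (coordl w)) suppP ?scalar_act0 //.
  apply: contra wl => wj; rewrite mem_undup; apply/flatten_mapP.
  exists (d (arrow_element k a) s`_j) => //.
  by apply/allpairsP; exists (a, s`_j); split; rewrite ?mem_enum ?mem_nth.
have Dl w a : klinear (fun m => coord w (d (arrow_element k a) m)).
  exact: klinear_comp (coordl w) (dl _).
have /choice[psi psiP] w := inner _ (path_derivationP (Dl w)).
pose Psi m : algebra_part Y := \sum_(w <- l) corner_act (psi w m) (\val w).
have Psil : klinear Psi.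
  apply: klinear_sum => w c x y; rewrite ((psiP w).1 c x y).
  by rewrite (zmod_morphD (corner_actBl (\val w))) corner_actZ.
exists Psi; split=> // x m; apply/eqP; rewrite -subr_eq0; apply/eqP; move: x m.
have PsiE x m : inner_derivation Psi x m = \sum_(w <- l)
    corner_act (path_derivation (fun a u => coord w (d (arrow_element k a) u)) x m)
      (\val w).
  rewrite /inner_derivation /Psi scaler_sumr -sumrB; apply: eq_bigr => w _.
  by rewrite (psiP w).2 /inner_derivation corner_actBl corner_actZ.
apply: path_derivation_eq0 => [|i m|a m].
- exact: derivation_sub dd (inner_derivationP Psil).
- rewrite dv PsiE big1 ?subrr // => w _.
  by rewrite path_derivation_vertex corner_act0.
rewrite PsiE -(derivation_arrow_corner a m dd dv).
rewrite {1}[d _ _](coordE _ l (undup_uniq _)) => [|w]; last exact: coord0.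
rewrite scaler_sumr -sumrB big1 // => w _.
by rewrite path_derivation_arrow /corner_map corner_actZ subrr.
Qed.

End FullPathModules.

Theorem theorem3p6 (k : closedFieldType) (Q : quiver)
    (T : lmodType (path_algebra k Q)) :
  finite_dimensional T ->
  (forall x : Ext 1%N T T, x = 0) ->
  forall M N : lmodType (one_point_extension T), full M -> full N ->
  forall x : Ext 2%N M N, x = 0.
Proof.
move=> Tfin ExtTT M N _ Nfull; apply: derivations_inner_Ext_eq0.
have innerTN := derivations_inner_full Tfin
  (Ext1_eq0_derivations_inner ExtTT) Nfull.
pose i : hom (syzygy 1 M) (free_module (one_point_extension T) M) :=
  mk_hom \val.
have iI : injective i by exact: val_inj.
apply: (derivations_inner_glue iI).
have [j jI] := algebra_part_hom iI.
have innerFN := derivations_inner_free (K := M) innerTN.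
exact: (derivations_inner_sub jI innerFN).
Qed.
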